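(* Let $A$ be a unital separable C*-algebra and $\alpha$ a *-automorphism of $A$. Given $k\ge1$, the C*-subalgebra of $\mathcal{L}(\mathcal{F})$ generated by all the periodic weighted representations of period $k$ on $\mathcal{F}$ (that is, by all operators $T_\lambda(a)$ with $a\in A$ and $\lambda$ a weight sequence of period $k$) is isomorphic to $M_k(\mathcal{T}_k)$, the algebra of all $k\times k$ matrices over the Toeplitz algebra $\mathcal{T}_k$ associated with $\alpha^k$.
   Context: For $n\ge1$ let $\mathcal{F}^{(n)}=\bigoplus_{j\ge0}A$ be the Hilbert $A$-module direct sum of countably many copies of $A$ (the Fock space of the C*-correspondence ${}_{\alpha^n}A$), where $\delta_ja$ denotes $a\in A$ in the $j$-th summand, and let $\mathcal{L}(\cdot)$ denote adjointable operators. For $a\in A$ define in $\mathcal{L}(\mathcal{F}^{(n)})$: $\phi_\infty^{(n)}(a)\delta_jb=\delta_j\alpha^{nj}(a)b$ and $T^{(n)}(a)\delta_jb=\delta_{j+1}\alpha^{nj}(a)b$. The Toeplitz algebra $\mathcal{T}_n$ is the C*-algebra generated by $\{\phi_\infty^{(n)}(a),T^{(n)}(a):a\in A\}$. Write $\mathcal{F}=\mathcal{F}^{(1)}$. For a bounded sequence $\lambda=\{\lambda_i\}_{i\ge1}$ of positive elements of $A$, the weighted representation $T_\lambda$ is $T_\lambda(a)\delta_jb=\delta_{j+1}\alpha^j(\lambda_{j+1}a)b$ ($a,b\in A$, $j\ge0$), an operator on $\mathcal{F}$; it is periodic of period $k$ if $\lambda_{i+k}=\lambda_i$ for all $i\ge1$.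 *)

(* Defs.v *)
From HB Require Import structures.
From mathcomp Require Import all_boot all_order all_algebra.
From mathcomp Require Import complex.
From mathcomp Require Import all_classical all_reals all_analysis.

Set Implicit Arguments.
Unset Strict Implicit.
Unset Printing Implicit Defensive.

Import Order.TTheory GRing.Theory Num.Theory.
Import numFieldNormedType.Exports.

Local Open Scope classical_set_scope.
Local Open Scope ring_scope.

(* The product is a field of the mixin rather than the one of [pzRingType]:    *)
(* MathComp's hierarchy has no join of rings and normed modules below          *)
(* [numDomainType]. The zero algebra is not excluded.                          *)
HB.mixin Record isUnitalCStar (R : realType) A
    of CompleteNormedModule R[i] A := {
  cmul : A -> A -> A;
  cone : A;
  star : A -> A;
  cmulA : associative cmul;
  cmul1l : left_id cone cmul;
  cmul1r : right_id cone cmul;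
  cmulDl : left_distributive cmul +%R;
  cmulDr : right_distributive cmul +%R;
  cmulZl : forall (c : R[i]) (a b : A), cmul (c *: a) b = c *: cmul a b;
  cmulZr : forall (c : R[i]) (a b : A), cmul a (c *: b) = c *: cmul a b;
  starK : involutive star;
  starD : {morph star : a b / a + b};
  starZ : forall (c : R[i]) (a : A), star (c *: a) = conjc c *: star a;
  starM : forall a b, star (cmul a b) = cmul (star b) (star a);
  norm_cmul_le : forall a b : A, `|cmul a b| <= `|a| * `|b|;
  norm_cstar : forall a : A, `|cmul (star a) a| = `|a| ^+ 2
}.

#[short(type="unitalCStarType")]
HB.structure Definition UnitalCStar (R : realType) :=
  {A of CompleteNormedModule R[i] A & isUnitalCStar R A}.

Declare Scope cstar_scope.
Notation "a ** b" := (cmul a b)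
  (at level 40, left associativity) : cstar_scope.
Local Open Scope cstar_scope.

Definition separable (T : topologicalType) : Prop :=
  exists D : set T, countable D /\ dense D.

Section CStarAlgebra.
Context {R : realType} {A : unitalCStarType R}.
Implicit Types (a b : A) (alpha : A -> A).

Definition spectrum a : set R[i] :=
  [set z | ~ exists b, b ** (a - z *: cone) = cone /\
                       (a - z *: cone) ** b = cone].

(* For z : R[i], [0 <= z] says that z is real and nonnegative. *)
Definition positive a : Prop :=
  star a = a /\ forall z, spectrum a z -> 0 <= z.

Record star_automorphism alpha : Prop := StarAutomorphism {
  star_aut_bij : bijective alpha;
  star_aut_linear : linear alpha;
  star_aut_mul : {morph alpha : a b / a ** b};
  star_aut_star : {morph alpha : a / star a}
}.

End CStarAlgebra.

(* The Hilbert A-module F is the set [l2] of the sequences x such that         *)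
(* \sum_j x_j^* x_j converges in norm. It does not depend on the power of      *)
(* alpha: as a right Hilbert A-module each F^(n) is the sum of copies of A.    *)
(* An operator on F is encoded as a map on all sequences that vanishes off F,  *)
(* so that equal operators are Leibniz-equal and the linear operations are the *)
(* pointwise ones.                                                             *)
Section HilbertModule.
Context {R : realType} {A : unitalCStarType R}.
Implicit Types (x y : nat -> A).

Definition l2 : set (nat -> A) :=
  [set x | cvgn (series (fun j => star (x j) ** x j))].

Definition inner x y : A := limn (series (fun j => star (x j) ** y j)).

Definition hnorm x : R := Num.sqrt (complex.Re `|inner x x|).

Definition delta (j : nat) (a : A) : nat -> A :=
  fun i => if i == j then a else 0.

Definition op : Type := (nat -> A) -> (nat -> A).
HB.instance Definition _ := GRing.Lmodule.on op.
HB.instance Definition _ := Choice.on op.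
Implicit Types (T S : op).

Definition extend0 (f : (nat -> A) -> (nat -> A)) : op :=
  fun x => if `[< l2 x >] then f x else 0.

Definition acts_on_l2 T : Prop :=
  (forall x, l2 x -> l2 (T x)) /\ (forall x, ~ l2 x -> T x = 0).

Definition is_adjoint T S : Prop :=
  [/\ acts_on_l2 T, acts_on_l2 S &
      forall x y, l2 x -> l2 y -> inner (T x) y = inner x (S y)].

Definition adjointable : set op := [set T | exists S, is_adjoint T S].

Definition adj T : op := xget 0 (is_adjoint T).

Definition opnorm T : \bar R :=
  ereal_sup [set (hnorm (T x))%:E | x in [set x | l2 x /\ hnorm x <= 1]].

Record cstar_subalgebra (B : set op) : Prop := CStarSubalgebra {
  csub_adjointable : B `<=` adjointable;
  csub0 : B 0;
  csubD : forall T S, B T -> B S -> B (T + S);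
  csubZ : forall (c : R[i]) T, B T -> B (c *: T);
  csubM : forall T S, B T -> B S -> B (T \o S);
  csub_adj : forall T, B T -> B (adj T);
  csub_closed : forall T, adjointable T ->
    (forall e : R, 0 < e -> exists2 S, B S & (opnorm (T - S)%R < e%:E)%E) ->
    B T
}.

Definition cstar_gen (G : set op) : set op := smallest cstar_subalgebra G.

End HilbertModule.
Arguments op {R} A.

Section Toeplitz.
Context {R : realType} {A : unitalCStarType R}.
Implicit Types (alpha : A -> A) (a : A) (lambda : nat -> A).

Definition phi_infty alpha (n : nat) a : op A :=
  extend0 (fun x j => iter (n * j) alpha a ** x j).

Definition creation alpha (n : nat) a : op A :=
  extend0 (fun x j => if j is i.+1 then iter (n * i) alpha a ** x i else 0).

Definition toeplitz alpha (n : nat) : set (op A) :=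
  cstar_gen (range (phi_infty alpha n) `|` range (creation alpha n)).

(* Weight sequences are indexed by i >= 1; the value lambda 0 is never used. *)
Definition weighted alpha lambda a : op A :=
  extend0 (fun x j =>
    if j is i.+1 then iter i alpha (lambda i.+1 ** a) ** x i else 0).

Record periodic_weight (k : nat) lambda : Prop := PeriodicWeight {
  weight_bounded : exists M : R[i], forall i, (1 <= i)%N -> `|lambda i| <= M;
  weight_positive : forall i, (1 <= i)%N -> positive (lambda i);
  weight_periodic : forall i, (1 <= i)%N -> lambda (i + k)%N = lambda i
}.

Definition periodic_algebra alpha (k : nat) : set (op A) :=
  cstar_gen [set T | exists lambda a,
                       periodic_weight k lambda /\ T = weighted alpha lambda a].

End Toeplitz.

(* A complex *-algebra presented as a subset of an ambient type carrying the   *)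
(* operations. A *-isomorphism between C*-algebras is isometric, and M_k(B)    *)
(* has only one C*-norm, so no norm is recorded here.                          *)
Record starAlgebra (C : Type) := StarAlgebra {
  sa_type : Type;
  sa_mem : set sa_type;
  sa_add : sa_type -> sa_type -> sa_type;
  sa_scale : C -> sa_type -> sa_type;
  sa_mul : sa_type -> sa_type -> sa_type;
  sa_star : sa_type -> sa_type
}.

Arguments sa_mem {C} s _.

Definition star_isomorphic (C : Type) (X Y : starAlgebra C) : Prop :=
  exists f : sa_type X -> sa_type Y,
    [/\ set_bij (sa_mem X) (sa_mem Y) f,
        forall S T, sa_mem X S -> sa_mem X T ->
          f (sa_add S T) = sa_add (f S) (f T),
        forall c T, sa_mem X T -> f (sa_scale c T) = sa_scale c (f T),
        forall S T, sa_mem X S -> sa_mem X T ->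
          f (sa_mul S T) = sa_mul (f S) (f T)
      & forall T, sa_mem X T -> f (sa_star T) = sa_star (f T)].

Section Algebras.
Context {R : realType} {A : unitalCStarType R}.

Definition op_algebra (B : set (op A)) : starAlgebra R[i] :=
  @StarAlgebra R[i] (op A) B +%R *:%R (fun S T => S \o T) adj.

Definition mx_algebra (k : nat) (B : set (op A)) : starAlgebra R[i] :=
  @StarAlgebra R[i] 'M[op A]_k
    [set M | forall i j, B (M i j)]
    +%R
    (fun c M => map_mx (fun T => c *: T) M)
    (fun M N => \matrix_(i, j) \sum_(l < k) (M i l \o N l j : op A))
    (fun M => \matrix_(i, j) adj (M j i)).

End Algebras.

Section Sanity.
Context {R : realType} {A : unitalCStarType R}.
Implicit Types (a b : A) (x y : nat -> A) (alpha : A -> A).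

Lemma cmul0l b : (0 : A) ** b = 0.
Proof. by apply: (@addrI _ (0 ** b)); rewrite -cmulDl !addr0. Qed.

Lemma cmul0r b : b ** (0 : A) = 0.
Proof. by apply: (@addrI _ (b ** 0)); rewrite -cmulDr !addr0. Qed.

Lemma star0 : star (0 : A) = 0.
Proof. by apply: (@addrI _ (star 0)); rewrite -starD !addr0. Qed.

Lemma star_cone : star (cone : A) = cone.
Proof. by rewrite -[LHS]cmul1l -[X in X ** _]starK -starM cmul1l starK. Qed.

Lemma cvg_series_one_term (u : nat -> A) (j : nat) :
  (forall i, i != j -> u i = 0) -> series u @ \oo --> u j.
Proof.
move=> u0; apply: cvg_near_cst.
exists j.+1 => // n /= jn.
rewrite /series /= big_mkord (bigD1 (Ordinal jn)) //= big1 ?addr0 // => i ij.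
by apply: u0; apply: contra ij => /eqP ij; apply/eqP/val_inj.
Qed.

Lemma l2_delta j a : l2 (delta j a).
Proof.
rewrite /l2 /=; apply/cvg_ex; exists (star (delta j a j) ** delta j a j).
apply: cvg_series_one_term => i /negPf ij.
by rewrite /delta ij cmul0r.
Qed.

Lemma inner_delta j a x : inner (delta j a) x = star a ** x j.
Proof.
apply/cvg_lim; first exact: norm_hausdorff.
have -> : star a ** x j = star (delta j a j) ** x j by rewrite /delta eqxx.
apply: (@cvg_series_one_term (fun i => star (delta j a i) ** x i)).
by move=> i /negPf ij; rewrite /delta ij star0 cmul0l.
Qed.

Lemma is_adjoint_uniq (T S S' : op A) :
  is_adjoint T S -> is_adjoint T S' -> S = S'.
Proof.
move=> [_ [_ S0] TS] [_ [_ S'0] TS']; apply/funext => y.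
have [yF|yF] := pselect (l2 y); last by rewrite S0 ?S'0.
apply/funext => j.
have : inner (delta j cone) (S y) = inner (delta j cone) (S' y).
  by rewrite -TS -?TS' //; exact: l2_delta.
by rewrite !inner_delta star_cone !cmul1l.
Qed.

Lemma adjE (T S : op A) : is_adjoint T S -> adj T = S.
Proof.
move=> TS; apply: (is_adjoint_uniq _ TS).
by rewrite /adj; case: xgetP => // /(_ S).
Qed.

Lemma phi_infty_delta alpha n a j b :
  phi_infty alpha n a (delta j b) = delta j (iter (n * j) alpha a ** b).
Proof.
rewrite /phi_infty /extend0 asboolT; last exact: l2_delta.
apply/funext => i; rewrite /delta.
by case: eqVneq => [->//|_]; rewrite cmul0r.
Qed.

Lemma creation_delta alpha n a j b :
  creation alpha n a (delta j b) = delta j.+1 (iter (n * j) alpha a ** b).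
Proof.
rewrite /creation /extend0 asboolT; last exact: l2_delta.
apply/funext => -[|i] //; rewrite /delta eqSS.
by case: eqVneq => [->//|_]; rewrite cmul0r.
Qed.

Lemma weighted_delta alpha lambda a j b :
  weighted alpha lambda a (delta j b) =
  delta j.+1 (iter j alpha (lambda j.+1 ** a) ** b).
Proof.
rewrite /weighted /extend0 asboolT; last exact: l2_delta.
apply/funext => -[|i] //; rewrite /delta eqSS.
by case: eqVneq => [->//|_]; rewrite cmul0r.
Qed.

End Sanity.

(* Main.v *)
(* The coordinates congruent to i modulo k form, for each i < k, a copy of the
   Fock space of alpha^k, so an operator on F is a k x k matrix of operators.
   In this picture T_lambda(a) has the entries phi(alpha^i(lambda_{i+1} a)) just
   below the diagonal and T(alpha^{k-1}(lambda_k a)) in the upper right corner.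
   Weights equal to 1 on one residue class and 0 elsewhere isolate a single
   entry; since T(1)^* T(a) = phi(a), products and adjoints of these produce
   every matrix with one entry phi(a) or T(a), and these generate M_k(T_k).

   Boundedness of these operators on F rests on the order of A. The cone used
   here consists of the self-adjoint a with |t - a| <= t for some t >= 0, which
   are the squares of self-adjoint elements; that x^* x lies in it is proved
   without the spectrum. *)

Require Import Defs.
From mathcomp Require Import all_boot all_order all_algebra.
From mathcomp Require Import complex.
From mathcomp Require Import all_classical all_reals all_analysis.
From mathcomp Require Import ring lra zify.

Set Implicit Arguments.
Unset Strict Implicit.
Unset Printing Implicit Defensive.

Import Order.TTheory GRing.Theory Num.Theory.
Import numFieldNormedType.Exports.

Local Open Scope classical_set_scope.
Local Open Scope ring_scope.
Local Open Scope complex_scope.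
Local Open Scope cstar_scope.

(** * Real-valued norm and convergence *)

(** Each of the two inclusions rests on the minimality of [cstar_gen]. The operators all of whose
    blocks lie in a given C*-subalgebra form a C*-subalgebra, and so do the operators all of whose
    placements in the k x k grid lie in it, so only generators have to be inspected. Norm limits
    pass because restricting to a residue class and inserting into one are contractive; the norm of
    the matrix algebra is never computed. The obstacle lies lower. An adjointable operator must
    preserve [l2], which is defined by norm convergence of series of elements [star x ** x];
    comparing two such series takes an order on which the norm is monotone. Contractivity of [alpha]
    is not among its axioms and has to be derived from the same order. All of this comes from the
    C*-identity and completeness, by way of square roots built by iteration and the bound 1 on the
    norm of a unitary. Spectral positivity has to be verified only for weights with values 0 and 1,
    where the resolvent is explicit. *)

Section RealNorm.
Context {R : realType} {A : unitalCStarType R}.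
Implicit Types (a b c : A) (r s t : R) (u v : nat -> A).

(** The norm of [A] takes values in [R[i]]. Its real part carries all of it and lives in an ordered
    field, where [lra] and [nra] apply. *)
Definition nrm a : R := complex.Re `|a|.

Lemma nrmE a : `|a| = (nrm a)%:C.
Proof.
have := normr_ge0 a; rewrite lecE /nrm => /andP[/eqP /= im0 _].
by case: `|a| im0 => x y /= ->.
Qed.

Lemma ltRC r s : (r%:C < s%:C) = (r < s).
Proof. by rewrite ltcE /= eqxx. Qed.

Lemma leRC r s : (r%:C <= s%:C) = (r <= s).
Proof. by rewrite lecE /= eqxx. Qed.

Lemma normRC (r : R) : `|r%:C : R[i]| = `|r|%:C.
Proof. by rewrite normc_def /= expr0n /= addr0 sqrtr_sqr. Qed.

Lemma nrm_ge0 a : 0 <= nrm a.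
Proof. by have := normr_ge0 a; rewrite nrmE leRC. Qed.

Lemma nrm0 : nrm 0 = 0.
Proof. by rewrite /nrm normr0. Qed.

Lemma nrm0_eq0 a : nrm a = 0 -> a = 0.
Proof. by move=> a0; apply: normr0_eq0; rewrite nrmE a0. Qed.

Lemma nrmN a : nrm (- a) = nrm a.
Proof. by rewrite /nrm normrN. Qed.

Lemma nrmB a b : nrm (a - b) = nrm (b - a).
Proof. by rewrite /nrm distrC. Qed.

Lemma nrmD a b : nrm (a + b) <= nrm a + nrm b.
Proof. by have := ler_normD a b; rewrite !nrmE -rmorphD leRC. Qed.

Lemma nrmZ r a : nrm (r%:C *: a) = `|r| * nrm a.
Proof. by rewrite /nrm normrZ normRC nrmE -rmorphM. Qed.

Lemma nrmZi a : nrm ('i *: a) = nrm a.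
Proof.
by rewrite /nrm normrZ normc_def /= expr0n /= add0r expr1n sqrtr1 mul1r.
Qed.

Lemma nrmM a b : nrm (a ** b) <= nrm a * nrm b.
Proof. by have := norm_cmul_le a b; rewrite !nrmE -rmorphM leRC. Qed.

Lemma nrm_cstar a : nrm (star a ** a) = nrm a ^+ 2.
Proof. by rewrite {1}/nrm norm_cstar nrmE -rmorphXn. Qed.

(** The C*-identity gives |b|^2 <= |star b| |b|; cancelling |b| and applying the result to [star a]
    as well gives equality. *)
Lemma nrm_star a : nrm (star a) = nrm a.
Proof.
have le b : nrm b <= nrm (star b).
  have [->|b0] := eqVneq (nrm b) 0; first exact: nrm_ge0.
  have bgt : 0 < nrm b by rewrite lt_neqAle eq_sym b0 nrm_ge0.
  by rewrite -(ler_pM2r bgt) -expr2 -nrm_cstar nrmM.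
by apply/le_anti; rewrite le andbT -{2}[a]starK le.
Qed.

Lemma nrm_sa_sqr a : star a = a -> nrm (a ** a) = nrm a ^+ 2.
Proof. by move=> {1}<-; exact: nrm_cstar. Qed.

(** Only an inequality, since the unit has norm 0 in the zero algebra. *)
Lemma nrm_cone_le1 : nrm (cone : A) <= 1.
Proof.
have := nrm_cstar (cone : A); rewrite star_cone cmul1l.
by have := nrm_ge0 (cone : A); nra.
Qed.

Lemma cmulNl a b : (- a) ** b = - (a ** b).
Proof. by rewrite -scaleN1r cmulZl scaleN1r. Qed.

Lemma cmulNr a b : a ** (- b) = - (a ** b).
Proof. by rewrite -scaleN1r cmulZr scaleN1r. Qed.

Lemma cmulBl a b c : (a - b) ** c = a ** c - b ** c.
Proof. by rewrite cmulDl cmulNl. Qed.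

Lemma cmulBr a b c : c ** (a - b) = c ** a - c ** b.
Proof. by rewrite cmulDr cmulNr. Qed.

Lemma starN a : star (- a) = - star a.
Proof. by rewrite -scaleN1r starZ rmorphN rmorph1 scaleN1r. Qed.

Lemma starB a b : star (a - b) = star a - star b.
Proof. by rewrite starD starN. Qed.

Lemma starZR r a : star (r%:C *: a) = r%:C *: star a.
Proof. by rewrite starZ conjc_real. Qed.

Lemma cvg_nrm u l : u @ \oo --> l <->
  forall e : R, 0 < e -> \forall n \near \oo, nrm (l - u n) < e.
Proof.
split=> [/cvgrPdist_lt ul e e0|ul].
  have : 0 < e%:C by rewrite ltRC.
  by move=> /ul; apply: filterS => n; rewrite nrmE ltRC.
apply/cvgrPdist_lt => -[x y]; rewrite ltcE /= => /andP[/eqP -> x0].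
by move: (ul _ x0); apply: filterS => n; rewrite nrmE ltRC.
Qed.

Lemma cvg_lip (f : A -> A) (C : R) u l :
  (forall a b, nrm (f a - f b) <= C * nrm (a - b)) ->
  u @ \oo --> l -> (fun n => f (u n)) @ \oo --> f l.
Proof.
move=> fC /cvg_nrm ul; apply/cvg_nrm => e e0.
have C1 : 0 < `|C| + 1 by have := normr_ge0 C; lra.
have := ul (e / (`|C| + 1)); rewrite divr_gt0 // => /(_ isT).
apply: filterS => n; rewrite ltr_pdivlMr // => un.
apply: (le_lt_trans (fC _ _)); apply: le_lt_trans un.
rewrite mulrC ler_wpM2l ?nrm_ge0 //.
by have := ler_norm C; lra.
Qed.

Lemma cvg_nrm_le u l (M : R) :
  u @ \oo --> l -> (\forall n \near \oo, nrm (u n) <= M) -> nrm l <= M.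
Proof.
move=> /cvg_nrm ul uM; apply/ler_addgt0Pr => e e0.
have [n [/= h1 h2]] := filter_ex (filterI (ul _ e0) uM).
by have := nrmD (l - u n) (u n); rewrite subrK; lra.
Qed.

Lemma cvg_cmull c u l : u @ \oo --> l -> (fun n => c ** u n) @ \oo --> c ** l.
Proof. by apply: (@cvg_lip _ (nrm c)) => a b; rewrite -cmulBr nrmM. Qed.

Lemma cvg_cmulr c u l : u @ \oo --> l -> (fun n => u n ** c) @ \oo --> l ** c.
Proof.
by apply: (@cvg_lip (fun a => a ** c) (nrm c)) => a b; rewrite -cmulBl mulrC nrmM.
Qed.

Lemma cvg_star u l : u @ \oo --> l -> (fun n => star (u n)) @ \oo --> star l.
Proof. by apply: (@cvg_lip _ 1) => a b; rewrite -starB nrm_star mul1r. Qed.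

Lemma cvgA_unique u (l l' : A) : u @ \oo --> l -> u @ \oo --> l' -> l = l'.
Proof. exact: (cvg_unique (@norm_hausdorff _ A)). Qed.

Lemma cauchy_cvg_nrm u :
  (forall e, 0 < e -> exists N, forall m n, (N <= m)%N -> (m <= n)%N ->
     nrm (u n - u m) < e) -> cvgn u.
Proof.
move=> uc; apply/cauchy_cvgP/cauchyP => -[x y].
rewrite ltcE /= => /andP[/eqP -> x0].
have [N uN] := uc _ x0; exists (u N); exists N => // n /= Nn.
by rewrite -ball_normE /ball_ /= nrmE ltRC nrmB; exact: uN.
Qed.

End RealNorm.

(** * Square roots and positivity *)

Section Positivity.
Context {R : realType} {A : unitalCStarType R}.
Implicit Types (a b c x y : A) (r s t : R).

(** A fixed point y of y -> (x + y^2)/2 satisfies (1 - y)^2 = 1 - x, so the iteration produces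
    square roots without the binomial series. *)
Fixpoint sqrt_iter x n : A :=
  if n is n'.+1 then 2^-1%:C *: (x + sqrt_iter x n' ** sqrt_iter x n') else 0.

Fixpoint sqrt_major n : R :=
  if n is n'.+1 then 2^-1 * (1 + sqrt_major n' ^+ 2) else 0.

Lemma sqrt_major_bound n : 0 <= sqrt_major n <= 1.
Proof. by elim: n => [|n /andP[ge0 le1]] /=; [rewrite lexx ler01|nra]. Qed.

Lemma sqrt_major_incr n : sqrt_major n <= sqrt_major n.+1.
Proof. by have /andP[] := sqrt_major_bound n => /=; nra. Qed.

Lemma sqrt_iter_le x n : nrm x <= 1 -> nrm (sqrt_iter x n) <= sqrt_major n.
Proof.
move=> x1; elim: n => [|n IH] /=; first by rewrite nrm0.
rewrite nrmZ gtr0_norm ?invr_gt0 // ler_pM2l ?invr_gt0 //.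
apply: (le_trans (nrmD _ _)); apply: lerD => //.
apply: (le_trans (nrmM _ _)).
by rewrite -expr2 ler_pXn2r ?nnegrE ?nrm_ge0 // (le_trans (nrm_ge0 _) IH).
Qed.

Lemma cmul_sqrB a b : a ** a - b ** b = a ** (a - b) + (a - b) ** b.
Proof. by rewrite cmulBr cmulBl addrA subrK. Qed.

(** The noncommutative identity a^2 - b^2 = a (a - b) + (a - b) b bounds the norm by (|a| + |b|) |a
    - b|, which is the exact factorization of the scalar increment. *)
Lemma sqrt_iter_step x n : nrm x <= 1 ->
  nrm (sqrt_iter x n.+1 - sqrt_iter x n) <= sqrt_major n.+1 - sqrt_major n.
Proof.
move=> x1; elim: n => [|n IH].
  rewrite /= !subr0 cmul0r addr0 nrmZ expr0n /= addr0.
  by rewrite gtr0_norm ?invr_gt0 // ler_pM2l ?invr_gt0.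
rewrite [in X in nrm X]/= -/(sqrt_iter x n.+1) -scalerBr opprD addrACA subrr add0r.
rewrite cmul_sqrB nrmZ gtr0_norm ?invr_gt0 //.
have h1 := nrmM (sqrt_iter x n.+1) (sqrt_iter x n.+1 - sqrt_iter x n).
have h2 := nrmM (sqrt_iter x n.+1 - sqrt_iter x n) (sqrt_iter x n).
have h3 := nrmD (sqrt_iter x n.+1 ** (sqrt_iter x n.+1 - sqrt_iter x n))
  ((sqrt_iter x n.+1 - sqrt_iter x n) ** sqrt_iter x n).
have h4 := sqrt_iter_le n.+1 x1; have h5 := sqrt_iter_le n x1.
have h6 := nrm_ge0 (sqrt_iter x n.+1); have h7 := nrm_ge0 (sqrt_iter x n).
have h8 := nrm_ge0 (sqrt_iter x n.+1 - sqrt_iter x n).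
have -> : sqrt_major n.+2 - sqrt_major n.+1 =
  2^-1 * ((sqrt_major n.+1 + sqrt_major n) * (sqrt_major n.+1 - sqrt_major n)).
  by rewrite /=; field.
rewrite ler_pM2l ?invr_gt0 //; apply: (le_trans h3).
apply: (@le_trans _ _ ((nrm (sqrt_iter x n.+1) + nrm (sqrt_iter x n)) *
  nrm (sqrt_iter x n.+1 - sqrt_iter x n))); first lra.
by apply: ler_pM => //; lra.
Qed.

Lemma sqrt_iter_dist x m n : nrm x <= 1 -> (m <= n)%N ->
  nrm (sqrt_iter x n - sqrt_iter x m) <= sqrt_major n - sqrt_major m.
Proof.
move=> x1; elim: n => [|n IH]; first by rewrite leqn0 => /eqP ->; rewrite !subrr nrm0.
rewrite leq_eqVlt => /orP[/eqP ->|]; first by rewrite !subrr nrm0.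
rewrite ltnS => /IH h; have h' := sqrt_iter_step n x1.
have -> : sqrt_iter x n.+1 - sqrt_iter x m =
  (sqrt_iter x n.+1 - sqrt_iter x n) + (sqrt_iter x n - sqrt_iter x m).
  by rewrite addrA subrK.
by apply: (le_trans (nrmD _ _)); lra.
Qed.

Lemma sqrt_iter_cvg x : nrm x <= 1 -> cvgn (sqrt_iter x).
Proof.
move=> x1; apply: cauchy_cvg_nrm => e e0.
have nd : nondecreasing_seq sqrt_major.
  by apply/nondecreasing_seqP; exact: sqrt_major_incr.
have tc : cvgn sqrt_major.
  apply: nondecreasing_is_cvgn => //; exists 1 => _ [n _ <-].
  by have /andP[] := sqrt_major_bound n.
have /cvgrPdist_lt/(_ _ e0)[N _ tN] := tc.
exists N => m n Nm mn; apply: (le_lt_trans (sqrt_iter_dist x1 mn)).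
have := tN m Nm; rewrite /= => /ltr_normlP [_ tm].
by have := nondecreasing_cvgn_le nd tc n; lra.
Qed.

Lemma scaleRCA r s a : r%:C *: (s%:C *: a) = (r * s)%:C *: a.
Proof. by rewrite scalerA -rmorphM. Qed.

Lemma scale2R a : 2%:C *: a = a + a.
Proof.
have -> : 2%:C = 1 + 1 :> R[i] by apply/eqP; rewrite eq_complex /= addr0 !eqxx.
by rewrite scalerDl scale1r.
Qed.

(* [y] is [1 - sqrt (1 - x)]; the iteration is dominated by the scalar one at [x = 1]. *)
Lemma sqrt_fixpoint x : nrm x <= 1 -> exists y,
  [/\ nrm y <= 1, y + y = x + y ** y, star x = x -> star y = y
    & forall c, c ** x = x ** c -> c ** y = y ** c].
Proof.
move=> x1; have /cvg_ex[y yl] := sqrt_iter_cvg x1.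
have it1 n : nrm (sqrt_iter x n) <= 1.
  by apply: (le_trans (sqrt_iter_le n x1)); have /andP[] := sqrt_major_bound n.
have y1 : nrm y <= 1 by apply: (cvg_nrm_le yl); apply: nearW.
exists y; split => //.
- have yS : (fun n => sqrt_iter x n.+1) @ \oo --> y.
    by have := yl; rewrite -cvg_shiftS.
  have yS' : (fun n => sqrt_iter x n.+1) @ \oo --> 2^-1%:C *: (x + y ** y).
    apply/cvg_nrm => e e0; have /cvg_nrm/(_ _ e0) := yl.
    apply: filterS => n ny /=.
    rewrite -scalerBr opprD addrACA subrr add0r cmul_sqrB nrmZ gtr0_norm ?invr_gt0 //.
    have h1 := nrmM y (y - sqrt_iter x n); have h2 := nrmM (y - sqrt_iter x n) (sqrt_iter x n).
    have h3 := nrmD (y ** (y - sqrt_iter x n)) ((y - sqrt_iter x n) ** sqrt_iter x n).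
    have := it1 n; have := nrm_ge0 y; have := nrm_ge0 (sqrt_iter x n).
    by have := nrm_ge0 (y - sqrt_iter x n); nra.
  have e := cvgA_unique yS yS'.
  by rewrite -scale2R {1}e scaleRCA divff ?rmorph1 ?scale1r.
- move=> sx; apply: (cvgA_unique (cvg_star yl)).
  suff -> : (fun n => star (sqrt_iter x n)) = sqrt_iter x by [].
  apply/funext; elim => [|n IH] /=; first by rewrite star0.
  by rewrite starZR starD starM sx IH.
- move=> c cx; apply: (cvgA_unique (cvg_cmull (c := c) yl)).
  suff -> : (fun n => c ** sqrt_iter x n) = (fun n => sqrt_iter x n ** c) by exact: cvg_cmulr.
  apply/funext; elim => [|n IH] /=; first by rewrite cmul0l cmul0r.
  by rewrite cmulZr cmulZl cmulDl cmulDr cx cmulA IH -cmulA IH cmulA.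
Qed.

(* [a + i b] is unitary. *)
Lemma circle_le1 a b : star a = a -> star b = b -> a ** b = b ** a ->
  a ** a + b ** b = cone -> nrm b <= 1.
Proof.
move=> sa sb ab e; pose w := 'i *: b.
have sw : star w = - w.
  rewrite /w starZ sb -scaleNr; congr (_ *: _).
  by apply/eqP; rewrite eq_complex /= !oppr0 !eqxx.
have aw : a ** w = w ** a by rewrite /w cmulZr cmulZl ab.
have ww : w ** w = - (b ** b).
  rewrite /w cmulZr cmulZl scalerA -scaleN1r; congr (_ *: _).
  by apply/eqP; rewrite eq_complex /= !mul0r !mulr0 mulr1 sub0r addr0 oppr0 !eqxx.
have u1 : star (a + w) ** (a + w) = cone.
  by rewrite starD sa sw cmulBl !cmulDr aw ww opprB addrACA subrr addr0.
have nu : nrm (a + w) <= 1.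
  have := nrm_cstar (a + w); rewrite u1; have := @nrm_cone_le1 R A.
  by have := nrm_ge0 (a + w); nra.
(* [2 w] is the difference of the unitary [a + w] and its adjoint, each of norm at most 1. *)
have : nrm (2%:C *: w) <= 2.
  have -> : 2%:C *: w = (a + w) - star (a + w).
    by rewrite starD sa sw opprB addrC addrA subrK scale2R.
  apply: (le_trans (nrmD _ _)); rewrite nrmN nrm_star; lra.
by rewrite nrmZ nrmZi gtr0_norm //; lra.
Qed.


(* The root of [1 - a ** a] lies on the unit circle with [a]. *)
Lemma sa_sqr_le1 a : star a = a -> nrm a <= 1 -> nrm (cone - a ** a) <= 1.
Proof.
move=> sa a1.
have aa1 : nrm (a ** a) <= 1.
  by rewrite nrm_sa_sqr // expr_le1 // nrm_ge0.
have [y [y1 yy sy cy]] := sqrt_fixpoint aa1.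
pose b := cone - y.
have bb : b ** b = cone - a ** a.
  rewrite /b cmulBl !cmulBr !cmul1l !cmul1r opprB addrACA.
    by rewrite -[- y - y]opprD yy opprD addrACA subrr addr0.
have ay : a ** y = y ** a by apply: cy; rewrite cmulA.
have sb : star b = b by rewrite starB star_cone sy // starM sa.
have b1 : nrm b <= 1.
  apply: (circle_le1 sa sb); last by rewrite bb addrC subrK.
  by rewrite /b cmulBr cmulBl ay cmul1l cmul1r.
by rewrite -bb nrm_sa_sqr // expr_le1 // nrm_ge0.
Qed.

(** In this form sums are immediate from the triangle inequality, and after division by [t] the
    condition is the hypothesis under which the square root iteration converges. *)
Definition psd a := star a = a /\ exists2 t, 0 <= t & nrm (t%:C *: cone - a) <= t.

Lemma psd_sa a : psd a -> star a = a. Proof. by case. Qed.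

Lemma psd0 : psd 0.
Proof. by split; [exact: star0|exists 0; rewrite // scale0r subr0 nrm0]. Qed.

Lemma psdD a b : psd a -> psd b -> psd (a + b).
Proof.
move=> [sa [s s0 as_]] [sb [t t0 bt]]; split; first by rewrite starD sa sb.
exists (s + t); first exact: addr_ge0.
rewrite rmorphD scalerDl opprD addrACA.
by apply: (le_trans (nrmD _ _)); exact: lerD.
Qed.

Lemma psdZ r a : 0 <= r -> psd a -> psd (r%:C *: a).
Proof.
move=> r0 [sa [t t0 at_]]; split; first by rewrite starZR sa.
exists (r * t); first exact: mulr_ge0.
by rewrite rmorphM -scalerA -scalerBr nrmZ ger0_norm // ler_wpM2l.
Qed.

(** With x = 1 - a/t the fixed point y gives (1 - y)^2 = a/t, so sqrt t (1 - y) is a root. The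
    commutation clause is recorded because [circle_le1] needs commuting roots. *)
Lemma psd_sqrt a : psd a -> exists b,
  [/\ psd b, b ** b = a & forall c, c ** a = a ** c -> c ** b = b ** c].
Proof.
move=> [sa [t t0 at_]].
(* The bound with [t = 0] forces [a = 0]; otherwise [a] can be rescaled by [t]. *)
have [te0|tn0] := eqVneq t 0.
  have -> : a = 0.
    apply: nrm0_eq0; apply/le_anti; rewrite nrm_ge0 andbT.
    by move: at_; rewrite te0 scale0r sub0r nrmN.
  exists 0; split; [exact: psd0|by rewrite cmul0l|by move=> c; rewrite cmul0l cmul0r].
have tp : 0 < t by rewrite lt_neqAle eq_sym tn0.
pose x := cone - t^-1%:C *: a.
have x1 : nrm x <= 1.
  have -> : x = t^-1%:C *: (t%:C *: cone - a).
    by rewrite scalerBr scaleRCA mulVf // rmorph1 scale1r.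
  by rewrite nrmZ gtr0_norm ?invr_gt0 // ler_pdivrMl ?mulr1.
have [y [y1 yy sy cy]] := sqrt_fixpoint x1.
have sx : star x = x by rewrite starB star_cone starZR sa.
exists ((Num.sqrt t)%:C *: (cone - y)); split.
- split; first by rewrite starZR starB star_cone sy.
  exists (Num.sqrt t); first exact: sqrtr_ge0.
  rewrite -scalerBr opprB addrC subrK nrmZ ger0_norm ?sqrtr_ge0 //.
  by rewrite ler_piMr ?sqrtr_ge0.
- rewrite cmulZl cmulZr scaleRCA -expr2 sqr_sqrtr //.
  have -> : (cone - y) ** (cone - y) = t^-1%:C *: a.
    rewrite cmulBl !cmulBr !cmul1l !cmul1r opprB addrACA.
    by rewrite -[- y - y]opprD yy opprD addrACA subrr addr0 /x subKr.
  by rewrite scaleRCA divff // rmorph1 scale1r.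
- move=> c ca; rewrite cmulZr cmulZl cmulBr cmulBl cmul1l cmul1r cy //.
  by rewrite /x cmulBr cmulBl cmul1l cmul1r cmulZr cmulZl ca.
Qed.

(** Dividing [b] by sqrt t reduces this to [sa_sqr_le1]. *)
Lemma sqr_le t b : 0 <= t -> star b = b -> nrm (b ** b) <= t ->
  nrm (t%:C *: cone - b ** b) <= t.
Proof.
move=> t0 sb; rewrite nrm_sa_sqr // => bt.
have [te0|tn0] := eqVneq t 0.
  have -> : b = 0.
    by apply: nrm0_eq0; have := nrm_ge0 b; move: bt; rewrite te0; nra.
  by rewrite te0 scale0r cmul0l subr0 nrm0.
have tp : 0 < t by rewrite lt_neqAle eq_sym tn0.
have sp : 0 < Num.sqrt t by rewrite sqrtr_gt0.
have ss : Num.sqrt t * Num.sqrt t = t by rewrite -expr2 sqr_sqrtr.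
pose c := (Num.sqrt t)^-1%:C *: b.
have -> : t%:C *: cone - b ** b = t%:C *: (cone - c ** c).
  rewrite scalerBr /c cmulZl cmulZr !scaleRCA -?mulrA -invfM ss divff //.
  by rewrite rmorph1 scale1r.
rewrite nrmZ gtr0_norm // ler_piMr //; apply: sa_sqr_le1; first by rewrite starZR sb.
rewrite nrmZ gtr0_norm ?invr_gt0 // ler_pdivrMl // mulr1.
by rewrite -(@ler_pXn2r _ 2) ?nnegrE ?nrm_ge0 ?sqrtr_ge0 // sqr_sqrtr.
Qed.

Lemma psd_sqr b : star b = b -> psd (b ** b).
Proof.
move=> sb; split; first by rewrite starM sb.
by exists (nrm (b ** b)); [exact: nrm_ge0|apply: sqr_le; rewrite ?nrm_ge0].
Qed.

(** The constant in the definition of [psd] may be replaced by any bound of the norm, because [a] is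
    a square. *)
Lemma psd_le a t : psd a -> nrm a <= t -> nrm (t%:C *: cone - a) <= t.
Proof.
move=> /psd_sqrt[b [/psd_sa sb <- _]] bt.
by apply: sqr_le => //; apply: le_trans bt; exact: nrm_ge0.
Qed.

Lemma psd_bound a t : psd a -> nrm a <= t -> psd (t%:C *: cone - a).
Proof.
move=> pa at_; split; first by rewrite starB starZR star_cone psd_sa.
exists t; first by apply: le_trans at_; exact: nrm_ge0.
by rewrite subKr.
Qed.

(** The root c of t - a commutes with a, hence with the root b of a. After division by sqrt t the
    two satisfy c^2 + b^2 = 1, and [circle_le1] bounds b. *)
Lemma psd_le_cone a t : 0 < t -> psd a -> psd (t%:C *: cone - a) -> nrm a <= t.
Proof.
move=> t0 pa /psd_sqrt[c [/psd_sa sc cc cC]].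
have [b [/psd_sa sb bb bC]] := psd_sqrt pa.
have ca : c ** a = a ** c.
  have : c ** (t%:C *: cone - a) = (t%:C *: cone - a) ** c by rewrite -cc cmulA.
  by rewrite cmulBr cmulBl cmulZr cmulZl cmul1l cmul1r => /addrI/oppr_inj.
have s0 : 0 < Num.sqrt t by rewrite sqrtr_gt0.
have ss : Num.sqrt t * Num.sqrt t = t by rewrite -expr2 sqr_sqrtr // ltW.
pose k := (Num.sqrt t)^-1%:C.
have kk x : k *: (k *: x) = t^-1%:C *: x by rewrite scaleRCA -invfM ss.
have : nrm (k *: b) <= 1.
  apply: (@circle_le1 (k *: c)); rewrite ?starZR ?sb ?sc //.
    by rewrite !cmulZl !cmulZr (bC _ ca).
  rewrite !cmulZl !cmulZr !kk bb cc -scalerDr subrK scaleRCA mulVf ?gt_eqF //.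
  by rewrite rmorph1 scale1r.
rewrite nrmZ gtr0_norm ?invr_gt0 // ler_pdivrMl // mulr1 => bs.
by rewrite -bb nrm_sa_sqr // -[t]ss -expr2 ler_pXn2r ?nnegrE ?nrm_ge0 ?sqrtr_ge0.
Qed.

(** For t above the norm of a + b, the element t - a is the sum of t - (a + b) and b. The slack [e]
    supplies the strictly positive [t] that [psd_le_cone] asks for. *)
Lemma psd_nrm_mono a b : psd a -> psd b -> nrm a <= nrm (a + b).
Proof.
move=> pa pb; apply/ler_addgt0Pr => e e0; apply: psd_le_cone => //.
  by have := nrm_ge0 (a + b); lra.
have -> : (nrm (a + b) + e)%:C *: cone - a
        = ((nrm (a + b) + e)%:C *: cone - (a + b)) + b.
  by rewrite opprD addrA subrK.
by apply: psdD => //; apply: psd_bound; [exact: psdD|rewrite lerDl ltW].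
Qed.

End Positivity.

(** * Positivity of star x ** x *)

Section GramPositivity.
Context {R : realType} {A : unitalCStarType R}.
Implicit Types (a b c x y : A) (r s t : R).

(* With [N] the norm of [c], [(N - y ** star y) ** y = y ** (N + c)], where the
   left factor has norm at most [N] and the right one increases the norm of [y]. *)
Lemma psd_opp_gram c y : psd c -> psd (y ** star y) -> star y ** y = - c -> c = 0.
Proof.
move=> pc ps yy; have sc := psd_sa pc.
pose N := nrm c; have N0 : 0 <= N := nrm_ge0 c.
have yN : nrm y ^+ 2 = N by rewrite -nrm_cstar yy nrmN.
have sN : nrm (y ** star y) = N by rewrite -yN -[nrm y]nrm_star -nrm_cstar starK.
pose g := N%:C *: cone + c.
have sg : star g = g by rewrite /g starD starZR star_cone sc.
have yg : (N%:C *: cone - y ** star y) ** y = y ** g.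
  rewrite cmulBl -cmulA yy cmulNr opprK /g cmulDr.
  by rewrite cmulZl cmulZr cmul1l cmul1r.
have le1 : nrm (y ** g) <= N * nrm y.
  rewrite -yg; apply: (le_trans (nrmM _ _)); apply: ler_wpM2r; first exact: nrm_ge0.
  by apply: psd_le; rewrite ?sN.
have le2 : nrm (g ** c ** g) <= N ^+ 3.
  have -> : g ** c ** g = - (star (y ** g) ** (y ** g)).
    by rewrite starM sg cmulA -[g ** star y ** y]cmulA yy cmulNr cmulNl opprK.
  rewrite nrmN nrm_cstar.
  have -> : N ^+ 3 = (N * nrm y) ^+ 2 by rewrite exprMn yN -exprSr.
  by rewrite ler_pXn2r ?nnegrE ?nrm_ge0 // mulr_ge0 ?nrm_ge0.
have [f [/psd_sa sf ff fC]] := psd_sqrt pc.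
have cf : c ** f = f ** c by exact: fC.
have pc3 : psd (c ** c ** c).
  have -> : c ** c ** c = (c ** f) ** (c ** f).
    by rewrite {2}cf -[RHS]cmulA [f ** (f ** c)]cmulA ff cmulA.
  by apply: psd_sqr; rewrite starM sf sc cf.
have gcg : g ** c ** g =
    (2 * N)%:C *: (c ** c) + ((N * N)%:C *: c + c ** c ** c).
  rewrite /g cmulDl cmulDr !cmulDl !cmulZl !cmulZr !cmul1l !cmul1r.
  rewrite -scaleRCA scale2R !scaleRCA addrA.
  rewrite [in RHS]addrA; congr (_ + _).
  by rewrite [in RHS]addrC addrA.
(* This summand of [g ** c ** g] has norm 2 N^3, while the whole has norm at most N^3; monotonicity
   of the norm leaves only N = 0. *)
have : nrm ((2 * N)%:C *: (c ** c)) <= N ^+ 3.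
  apply: le_trans le2; rewrite gcg; apply: psd_nrm_mono.
    by apply: psdZ; [rewrite mulr_ge0|exact: psd_sqr].
  by apply: psdD => //; apply: psdZ => //; rewrite mulr_ge0.
rewrite nrmZ ger0_norm ?mulr_ge0 // nrm_sa_sqr // -/N => h.
apply: nrm0_eq0; rewrite -/N; apply/eqP; rewrite eq_le N0 andbT.
rewrite leNgt; apply/negP => Np; have N3 := exprn_gt0 3 Np; rewrite -mulrA -exprS in h.
suff : (0 : R) < 0 by rewrite ltxx.
by lra.
Qed.

(** Up to real factors [u] and [v] are the real and imaginary parts of [y], and the terms y^2 and
    (star y)^2 cancel in u^2 + v^2. *)
Lemma psd_gram_sum y : psd (y ** star y + star y ** y).
Proof.
pose u := y + star y; pose v := 'i *: (y - star y).
have su : star u = u by rewrite starD starK addrC.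
have sv : star v = v.
  rewrite starZ starB starK -opprB scalerN -scaleNr; congr (_ *: _).
  by apply/eqP; rewrite eq_complex /= oppr0 opprK !eqxx.
have vv : v ** v = - ((y - star y) ** (y - star y)).
  rewrite /v cmulZr cmulZl scalerA; apply: etrans (scaleN1r _); congr (_ *: _).
  by apply/eqP; rewrite eq_complex /= !mul0r !mulr0 mulr1 sub0r addr0 oppr0 !eqxx.
have -> : y ** star y + star y ** y = 2^-1%:C *: (u ** u + v ** v).
  have -> : u ** u + v ** v = 2%:C *: (y ** star y + star y ** y).
    rewrite vv /u cmulBl !cmulBr cmulDl !cmulDr scale2R.
    rewrite !opprB; set p := y ** y; set q := star y ** star y.
    set m := y ** star y; set n := star y ** y.
    rewrite [n - q + _]addrC addrACA [p + m]addrC [m + p + _]addrACA.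
    by rewrite [n + q + _]addrACA !subrr !addr0 addrACA.
  by rewrite scaleRCA mulVf // rmorph1 scale1r.
apply: psdZ; first by rewrite invr_ge0.
by apply: psdD; exact: psd_sqr.
Qed.

(* With [h = star x ** x] and [q = |h| - h], twice the negative part of [h], the
   element [y = x ** q] satisfies [star y ** y = - (q ** |h| ** q)]; hence [q = 0]. *)
Lemma psd_gram x : psd (star x ** x).
Proof.
pose h := star x ** x.
have sh : star h = h by rewrite starM starK.
have [d [pd dd dC]] := psd_sqrt (psd_sqr sh).
have hd : h ** d = d ** h by apply: dC; rewrite cmulA.
have [e [/psd_sa se ee eC]] := psd_sqrt pd.
have sd := psd_sa pd.
pose q := d - h.
have sq : star q = q by rewrite starB sh sd.
have hq : h ** q = - (d ** q) by rewrite !cmulBr hd dd opprB.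
have dq : d ** q = q ** d by rewrite cmulBr cmulBl hd.
have qq : q ** q = d ** q + d ** q by rewrite {1}/q cmulBl hq opprK.
have eq_ : e ** q = q ** e.
  by rewrite cmulBr cmulBl -(eC _ hd) -(eC _ (erefl (d ** d))).
have hE : h = d - q by rewrite subKr.
clearbody q.
pose c := q ** d ** q.
have pc : psd c.
  have -> : c = star (e ** q) ** (e ** q).
    by rewrite starM se sq cmulA -[q ** e ** e]cmulA ee.
  by rewrite {1}starM sq se -eq_; apply: psd_sqr; rewrite starM sq se.
pose y := x ** q.
have yy : star y ** y = - c.
  by rewrite starM sq cmulA -[q ** _ ** _]cmulA -/h -cmulA hq cmulNr cmulA.
have c0 : c = 0.
  apply: (psd_opp_gram pc _ yy).
  (* Since [star y ** y] is [- c], the element [y ** star y] equals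
     [(y ** star y + star y ** y) + c], a sum of two elements of the cone. *)
  rewrite -[y ** _](addrK (star y ** y)) yy opprK -yy.
  by apply: psdD => //; exact: psd_gram_sum.
(* From q^2 = 2 d q the fourth power of q is 4 d (q d q), which vanishes with [c]; the C*-identity,
   used twice, then gives q = 0. *)
have q0 : q = 0.
  have : nrm (q ** q ** (q ** q)) = 0.
    rewrite qq cmulDl !cmulDr !cmulA.
    have -> : d ** q ** d ** q = 0.
      by rewrite -!cmulA [q ** (d ** q)]cmulA -/c c0 cmul0r.
    by rewrite !addr0 nrm0.
  rewrite nrm_sa_sqr ?starM ?sq // nrm_sa_sqr // => /eqP.
  by rewrite !expf_eq0 => /eqP/nrm0_eq0.
by rewrite -/h hE q0 subr0.
Qed.

Lemma psd_conj a x : psd a -> psd (star x ** a ** x).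
Proof.
move=> /psd_sqrt[b [/psd_sa sb <- _]].
by have := psd_gram (b ** x); rewrite starM sb !cmulA.
Qed.

(** The difference is the conjugate by [a] of M^2 - star b ** b. This is the estimate by which a
    diagonal operator with bounded entries preserves [l2]. *)
Lemma psd_cmul_bound a b (M : R) : nrm b <= M ->
  psd ((M ^+ 2)%:C *: (star a ** a) - star (b ** a) ** (b ** a)).
Proof.
move=> bM.
have -> : (M ^+ 2)%:C *: (star a ** a) - star (b ** a) ** (b ** a) =
   star a ** ((M ^+ 2)%:C *: cone - star b ** b) ** a.
  by rewrite cmulBr cmulBl cmulZr cmul1r cmulZl starM !cmulA.
apply: psd_conj; apply: psd_bound; first exact: psd_gram.
rewrite nrm_cstar ler_pXn2r ?nnegrE ?nrm_ge0 //.
by apply: le_trans bM; exact: nrm_ge0.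
Qed.

(** * Automorphisms are contractive *)

Section Automorphism.
Variable alpha : A -> A.
Hypothesis halpha : star_automorphism alpha.

Lemma aut_cone : alpha cone = cone.
Proof.
case: halpha => [[g ag ga]] _ aM _.
by rewrite -[LHS]cmul1r -{2}[cone]ga -aM cmul1l ga.
Qed.

Lemma aut0 : alpha 0 = 0.
Proof.
have := star_aut_linear halpha (-1) 0 0.
by rewrite scaler0 addr0 scaleN1r addNr.
Qed.

Lemma autD a b : alpha (a + b) = alpha a + alpha b.
Proof. by have := star_aut_linear halpha 1 a b; rewrite !scale1r. Qed.

Lemma autZ (z : R[i]) a : alpha (z *: a) = z *: alpha a.
Proof. by have := star_aut_linear halpha z a 0; rewrite aut0 !addr0. Qed.

Lemma autB a b : alpha (a - b) = alpha a - alpha b.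
Proof. by rewrite autD -scaleN1r autZ scaleN1r. Qed.

(** The element |a|^2 - star a ** a is the square of a self-adjoint element, and [alpha] maps such
    squares to such squares; [psd_le_cone] turns this back into a norm bound. *)
Lemma aut_contract a : nrm (alpha a) <= nrm a.
Proof.
have [->|a0] := eqVneq a 0; first by rewrite aut0.
have ap : 0 < nrm a.
  rewrite lt_neqAle nrm_ge0 andbT eq_sym.
  by apply: contra a0 => /eqP/nrm0_eq0 ->.
rewrite -(@ler_pXn2r _ 2) ?nnegrE ?nrm_ge0 // -nrm_cstar.
apply: psd_le_cone; [by rewrite exprn_gt0|exact: psd_gram|].
have : psd ((nrm a ^+ 2)%:C *: cone - star a ** a).
  by apply: psd_bound; [exact: psd_gram|rewrite nrm_cstar].
move=> /psd_sqrt[c [/psd_sa sc cc _]].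
have -> : (nrm a ^+ 2)%:C *: cone - star (alpha a) ** alpha a = alpha c ** alpha c.
  rewrite -(star_aut_mul halpha) cc autB autZ aut_cone.
  by rewrite (star_aut_mul halpha) (star_aut_star halpha).
by apply: psd_sqr; rewrite -(star_aut_star halpha) sc.
Qed.

Lemma iter_aut_contract n a : nrm (iter n alpha a) <= nrm a.
Proof.
by elim: n => //= n IH; apply: le_trans IH; exact: aut_contract.
Qed.

Lemma iter_aut_cone n : iter n alpha cone = cone.
Proof. by elim: n => //= n ->; exact: aut_cone. Qed.

Lemma iter_aut0 n : iter n alpha 0 = 0.
Proof. by elim: n => //= n ->; exact: aut0. Qed.

Lemma iter_aut_star n a : iter n alpha (star a) = star (iter n alpha a).
Proof. by elim: n => //= n ->; exact: (star_aut_star halpha). Qed.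

Lemma iter_aut_mul n a b : iter n alpha (a ** b) = iter n alpha a ** iter n alpha b.
Proof. by elim: n => //= n ->; exact: (star_aut_mul halpha). Qed.

Lemma iter_aut_surj n a : exists b, iter n alpha b = a.
Proof.
case: halpha => [[g ag ga]] _ _ _; exists (iter n g a).
by elim: n a => // n IH a; rewrite iterSr iterS ga.
Qed.

End Automorphism.
End GramPositivity.

(** * Adjointable operators on F *)

Section HilbertModuleTheory.
Context {R : realType} {A : unitalCStarType R}.
Implicit Types (a b c : A) (u v x y z : nat -> A) (T S : op A).

Lemma psd_sum (F : nat -> A) m n :
  (forall j, psd (F j)) -> psd (\sum_(m <= j < n) F j).
Proof.
move=> pF; elim/big_ind: _ => [|p q|j _]; [exact: psd0|exact: psdD|exact: pF].
Qed.

Lemma series_cvgD u v (l m : A) : series u @ \oo --> l -> series v @ \oo --> m ->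
  series (fun j => u j + v j) @ \oo --> l + m.
Proof. by move=> ul vm; rewrite (seriesD u v); exact: cvgD. Qed.

Lemma series_cvgZ (k : R[i]) u (l : A) : series u @ \oo --> l ->
  series (fun j => k *: u j) @ \oo --> k *: l.
Proof. by move=> ul; rewrite (seriesZ u k); exact: cvgZl_tmp. Qed.

Arguments series_cvgZ k {u l} _.

Lemma series_cvgB u v (l m : A) : series u @ \oo --> l -> series v @ \oo --> m ->
  series (fun j => u j - v j) @ \oo --> l - m.
Proof.
move=> ul vm; have := series_cvgD ul (series_cvgZ (-1) vm).
by rewrite scaleN1r; under eq_fun do rewrite scaleN1r.
Qed.

Lemma series_cvg_star u (l : A) : series u @ \oo --> l ->
  series (fun j => star (u j)) @ \oo --> star l.
Proof.
move=> /cvg_star; rewrite (_ : (fun n => _) = series (fun j => star (u j))) //.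
apply/funext => n; rewrite /series /=.
by apply: (big_morph star) => [a b|]; [exact: starD|exact: star0].
Qed.

Section Domination.
Variables u v : nat -> A.
Hypotheses (pu : forall j, psd (u j)) (puv : forall j, psd (v j - u j)).

Lemma nrm_sum_dominated m n :
  nrm (\sum_(m <= j < n) u j) <= nrm (\sum_(m <= j < n) v j).
Proof.
have -> : \sum_(m <= j < n) v j =
    \sum_(m <= j < n) u j + \sum_(m <= j < n) (v j - u j).
  by rewrite -big_split /=; apply: eq_bigr => j _; rewrite addrC subrK.
by apply: psd_nrm_mono; exact: psd_sum.
Qed.

(** Each slice of [u] has norm at most that of the same slice of [v], so the Cauchy criterion passes
    from [v] to [u]. *)
Lemma cvg_series_dominated : cvgn (series v) -> cvgn (series u).
Proof.
move=> /cvg_cauchy/cauchy_seriesP vc; apply/cauchy_cvgP/cauchy_seriesP => e /vc.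
apply: filterS => -[m n] /=; apply: le_lt_trans.
by rewrite !nrmE leRC nrm_sum_dominated.
Qed.

Lemma nrm_lim_dominated : cvgn (series v) ->
  nrm (limn (series u)) <= nrm (limn (series v)).
Proof.
move=> vc; have uc := cvg_series_dominated vc.
apply/ler_addgt0Pr => e e0; apply: (cvg_nrm_le uc).
have /cvg_nrm/(_ _ e0) := vc; apply: filterS => n vn.
apply: (le_trans (nrm_sum_dominated 0 n)).
rewrite -[X in nrm X](subrK (limn (series v))) addrC.
by apply: (le_trans (nrmD _ _)); rewrite lerD2l nrmB ltW.
Qed.

End Domination.

Definition gram x : nat -> A := fun j => star (x j) ** x j.

Lemma psd_gramj x j : psd (gram x j).
Proof. exact: psd_gram. Qed.

Lemma l2_dominated (C : R) x y :
  (forall j, psd (C%:C *: gram y j - gram x j)) -> l2 y -> l2 x.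
Proof.
move=> xy ly; apply: (@cvg_series_dominated _ (fun j => C%:C *: gram y j)) => //.
  exact: psd_gramj.
exact: cvgP (series_cvgZ _ ly).
Qed.

Lemma l2_0 : l2 (0 : nat -> A).
Proof.
rewrite (_ : 0 = delta 0 0); first exact: l2_delta.
by apply/funext => j; rewrite /delta if_same.
Qed.

Lemma l2Z (k : R[i]) x : l2 x -> l2 (k *: x).
Proof.
move=> lx; rewrite /l2 /=.
apply: (cvgP (conjc k * k *: limn (series (gram x)))).
rewrite (_ : (fun j => _) = (fun j => (conjc k * k) *: gram x j)).
  exact: series_cvgZ _ lx.
by apply/funext => j; rewrite /gram /= starZ cmulZl cmulZr scalerA.
Qed.

(** Dropping the second square bounds the Gram element of a sum, which makes [l2] stable under
    addition without a Cauchy-Schwarz inequality. *)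
Lemma gram_parallelogram a b :
  star (a + b) ** (a + b) + star (a - b) ** (a - b) =
  2%:C *: (star a ** a) + 2%:C *: (star b ** b).
Proof.
rewrite starD starB cmulBl !cmulBr cmulDl !cmulDr !scale2R.
set p := star a ** a; set q := star b ** b.
set m := star a ** b; set n := star b ** a.
rewrite opprB addrACA [p + m + _]addrACA subrr addr0.
by rewrite [n + q]addrC [q + n + _]addrACA subrr addr0.
Qed.

Lemma l2D x y : l2 x -> l2 y -> l2 (x + y).
Proof.
move=> lx ly.
apply: (@cvg_series_dominated _ (fun j => 2%:C *: gram x j + 2%:C *: gram y j)).
- exact: psd_gramj.
- move=> j; have -> : 2%:C *: gram x j + 2%:C *: gram y j - gram (x + y) j =
    star (x j - y j) ** (x j - y j).
    by rewrite /gram /= -gram_parallelogram addrC addrA addNr add0r.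
  exact: psd_gram.
- exact: cvgP (series_cvgD (series_cvgZ _ lx) (series_cvgZ _ ly)).
Qed.

Lemma l2_sum (I : Type) (r : seq I) (P : pred I) (F : I -> nat -> A) :
  (forall i, P i -> l2 (F i)) -> l2 (\sum_(i <- r | P i) F i).
Proof. by move=> lF; elim/big_ind: _ => //; [exact: l2_0|exact: l2D]. Qed.

Definition pairing x y : nat -> A := fun j => star (x j) ** y j.

(** Writes [star a ** b] through Gram elements alone, so that the series of an inner product
    converges because [l2] is a linear space. *)
Lemma polarization a b :
  2%:C *: (star a ** b) =
    (star (a + b) ** (a + b) - (star a ** a + star b ** b)) +
    'i *: (star (b + 'i *: a) ** (b + 'i *: a) - (star a ** a + star b ** b)).
Proof.
set p := star a ** a; set q := star b ** b.
have ii (w : A) : 'i *: ('i *: w) = - w.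
  rewrite scalerA; apply: etrans (scaleN1r _); congr (_ *: _).
  by apply/eqP; rewrite eq_complex /= !mul0r !mulr0 mulr1 sub0r addr0 oppr0 !eqxx.
have ci (w : A) : conjc 'i *: w = - ('i *: w).
  rewrite -scaleNr; congr (_ *: _).
  by apply/eqP; rewrite eq_complex /= !oppr0 !eqxx.
have gB (c d : A) : star (d + c) ** (d + c) - (star c ** c + star d ** d) =
    star d ** c + star c ** d.
  rewrite starD cmulDl !cmulDr [star c ** c + star d ** d]addrC opprD addrACA.
  by rewrite [star d ** d + _]addrC !addrK.
have gi : star ('i *: a) ** ('i *: a) = p.
  by rewrite starZ cmulZl cmulZr ci ii opprK.
have := gB ('i *: a) b; rewrite gi => ->; rewrite [a + b]addrC gB.
rewrite starZ cmulZl cmulZr ci scalerBr !ii opprK scale2R.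
by rewrite addrACA subrr add0r.
Qed.

Lemma inner_cvg x y : l2 x -> l2 y -> cvgn (series (pairing x y)).
Proof.
move=> lx ly; have lg := series_cvgD lx ly.
have lp := series_cvgB (l2D lx ly) lg.
have lm := series_cvgB (l2D ly (l2Z (k := 'i) lx)) lg.
have := series_cvgZ 2^-1%:C (series_cvgD lp (series_cvgZ 'i lm)).
set w := fun j => _; have -> : w = pairing x y; last by move/cvgP.
apply/funext => j; rewrite /w /= -polarization scaleRCA mulVf //.
by rewrite rmorph1 scale1r.
Qed.

Lemma inner_lim x y : l2 x -> l2 y -> series (pairing x y) @ \oo --> inner x y.
Proof. exact: inner_cvg. Qed.

Lemma innerE x y (l : A) : series (pairing x y) @ \oo --> l -> inner x y = l.
Proof. by move=> h; apply/cvg_lim => //; exact: norm_hausdorff. Qed.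

Lemma innerDr x y z : l2 x -> l2 y -> l2 z ->
  inner x (y + z) = inner x y + inner x z.
Proof.
move=> lx ly lz; apply: innerE.
have := series_cvgD (inner_lim lx ly) (inner_lim lx lz).
by under eq_fun do rewrite -cmulDr.
Qed.

Lemma innerZr (k : R[i]) x y : l2 x -> l2 y -> inner x (k *: y) = k *: inner x y.
Proof.
move=> lx ly; apply: innerE.
have := series_cvgZ k (inner_lim lx ly).
by under eq_fun do rewrite -cmulZr.
Qed.

Lemma inner_star x y : l2 x -> l2 y -> star (inner x y) = inner y x.
Proof.
move=> lx ly; apply/esym/innerE.
have := series_cvg_star (inner_lim lx ly).
by under eq_fun do rewrite starM starK.
Qed.

Lemma innerDl x y z : l2 x -> l2 y -> l2 z ->
  inner (x + y) z = inner x z + inner y z.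
Proof.
move=> lx ly lz; rewrite -inner_star ?innerDr ?starD ?inner_star //; exact: l2D.
Qed.

Lemma innerZl (k : R[i]) x y : l2 x -> l2 y ->
  inner (k *: x) y = conjc k *: inner x y.
Proof.
move=> lx ly; rewrite -inner_star ?innerZr ?starZ ?inner_star //; exact: l2Z.
Qed.

Lemma adjoint_sym T S : is_adjoint T S -> is_adjoint S T.
Proof.
move=> [aT aS TS]; split => // x y lx ly.
have [lT _] := aT; have [lS _] := aS.
by rewrite -(inner_star ly (lS _ lx)) -TS // inner_star //; exact: lT.
Qed.

(** Coordinates of [T x] are inner products of [x] with fixed vectors. Linearity of [T], which
    [is_adjoint] does not ask for, follows from that of [inner]. *)
Lemma adjoint_coord T S x j : is_adjoint T S -> l2 x ->
  T x j = inner (S (delta j cone)) x.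
Proof.
move=> /adjoint_sym[_ [lT _] ST] lx; rewrite ST //; last exact: l2_delta.
by rewrite inner_delta star_cone cmul1l.
Qed.

Lemma adjoint_l2 T S x : is_adjoint T S -> l2 x -> l2 (T x).
Proof. by move=> [[lT _] _ _]; exact: lT. Qed.

Lemma adjoint_out T S x : is_adjoint T S -> ~ l2 x -> T x = 0.
Proof. by move=> [[_ T0] _ _]; exact: T0. Qed.

Lemma adjoint_linD T S x y : is_adjoint T S -> l2 x -> l2 y -> T (x + y) = T x + T y.
Proof.
move=> TS lx ly; apply/funext => j.
have ld := adjoint_l2 (adjoint_sym TS) (@l2_delta R A j cone).
change (T (x + y) j = T x j + T y j).
by rewrite !(adjoint_coord _ TS) ?innerDr //; exact: l2D.
Qed.

Lemma adjoint_linZ T S k x : is_adjoint T S -> l2 x -> T (k *: x) = k *: T x.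
Proof.
move=> TS lx; apply/funext => j.
have ld := adjoint_l2 (adjoint_sym TS) (@l2_delta R A j cone).
change (T (k *: x) j = k *: T x j).
by rewrite !(adjoint_coord _ TS) ?innerZr //; exact: l2Z.
Qed.

Lemma adjoint_lin0 T S : is_adjoint T S -> T 0 = 0.
Proof.
by move=> TS; have := adjoint_linZ 0 TS l2_0; rewrite !scale0r.
Qed.

Lemma adjoint_lin_sum T S (I : Type) (r : seq I) (F : I -> nat -> A) :
  is_adjoint T S -> (forall i, l2 (F i)) ->
  T (\sum_(i <- r) F i) = \sum_(i <- r) T (F i).
Proof.
move=> TS lF; elim: r => [|i r IH]; first by rewrite !big_nil (adjoint_lin0 TS).
by rewrite !big_cons (adjoint_linD TS) ?IH //; exact: l2_sum.
Qed.

Lemma adjoint_comp T T' S S' :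
  is_adjoint T S -> is_adjoint T' S' -> is_adjoint (T \o T') (S' \o S).
Proof.
move=> TS TS'; have ST := adjoint_sym TS; have ST' := adjoint_sym TS'; split.
- split=> x lx /=; first exact: (adjoint_l2 TS (adjoint_l2 TS' lx)).
  by rewrite (adjoint_out TS' lx) (adjoint_lin0 TS).
- split=> x lx /=; first exact: (adjoint_l2 ST' (adjoint_l2 ST lx)).
  by rewrite (adjoint_out ST lx) (adjoint_lin0 ST').
- move=> x y lx ly /=; have [_ _ ->] := TS => //; last exact: (adjoint_l2 TS').
  by have [_ _ ->] := TS' => //; exact: (adjoint_l2 ST).
Qed.

Lemma adjoint_add T T' S S' :
  is_adjoint T S -> is_adjoint T' S' -> is_adjoint (T + T') (S + S').
Proof.
move=> TS TS'; have ST := adjoint_sym TS; have ST' := adjoint_sym TS'; split.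
- split=> x lx /=; first by apply: l2D; [exact: (adjoint_l2 TS)|exact: (adjoint_l2 TS')].
  by rewrite /GRing.add /= (adjoint_out TS lx) (adjoint_out TS' lx) addr0.
- split=> x lx /=; first by apply: l2D; [exact: (adjoint_l2 ST)|exact: (adjoint_l2 ST')].
  by rewrite /GRing.add /= (adjoint_out ST lx) (adjoint_out ST' lx) addr0.
- move=> x y lx ly.
  rewrite [LHS]innerDl //; [|exact: (adjoint_l2 TS)|exact: (adjoint_l2 TS')].
  rewrite [RHS]innerDr //; [|exact: (adjoint_l2 ST)|exact: (adjoint_l2 ST')].
  by have [_ _ ->] := TS => //; have [_ _ ->] := TS'.
Qed.

Lemma adjoint_scale k T S : is_adjoint T S -> is_adjoint (k *: T) (conjc k *: S).
Proof.
move=> TS; have ST := adjoint_sym TS; split.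
- split=> x lx /=; first by apply: l2Z; exact: (adjoint_l2 TS).
  by rewrite /GRing.scale /= (adjoint_out TS lx) scaler0.
- split=> x lx /=; first by apply: l2Z; exact: (adjoint_l2 ST).
  by rewrite /GRing.scale /= (adjoint_out ST lx) scaler0.
- move=> x y lx ly.
  rewrite [LHS]innerZl //; last exact: (adjoint_l2 TS).
  rewrite [RHS]innerZr //; last exact: (adjoint_l2 ST).
  by have [_ _ ->] := TS.
Qed.

Lemma adjoint_0 : is_adjoint (0 : op A) 0.
Proof.
split; [by split=> // x _; exact: l2_0|by split=> // x _; exact: l2_0|].
move=> x y lx ly; transitivity (0 : A).
  apply: innerE; rewrite (_ : series _ = fun=> 0); first exact: cvg_cst.
  by apply/funext => n; apply: big1 => j _; rewrite /pairing star0 cmul0l.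
symmetry; apply: innerE; rewrite (_ : series _ = fun=> 0); first exact: cvg_cst.
by apply/funext => n; apply: big1 => j _; rewrite /pairing cmul0r.
Qed.

Lemma adjointableE T : adjointable T -> is_adjoint T (adj T).
Proof. by move=> [S TS]; rewrite (adjE TS). Qed.

(** The closure clause only concerns adjointable limits, so it is immediate here. This is the
    largest C*-subalgebra, and it keeps everything generated by adjointable operators
    adjointable. *)
Lemma cstar_subalgebra_adjointable : cstar_subalgebra (@adjointable R A).
Proof.
split => //.
- by exists 0; exact: adjoint_0.
- by move=> T S [T' TT'] [S' SS']; exists (T' + S'); exact: adjoint_add.
- by move=> c T [T' TT']; exists (conjc c *: T'); exact: adjoint_scale.
- by move=> T S [T' TT'] [S' SS']; exists (S' \o T'); exact: adjoint_comp.
- by move=> T /adjointableE/adjoint_sym h; exists T.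
Qed.

Lemma cstar_subalgebra_gen (G : set (op A)) :
  G `<=` adjointable -> cstar_subalgebra (cstar_gen G).
Proof.
move=> GA; split.
- by move=> T /(_ _ (conj cstar_subalgebra_adjointable GA)).
- by move=> B [cB _]; exact: csub0 cB.
- by move=> T S GT GS B cB; apply: (csubD (proj1 cB)); [exact: GT|exact: GS].
- by move=> c T GT B cB; apply: (csubZ (proj1 cB)); exact: GT.
- by move=> T S GT GS B cB; apply: (csubM (proj1 cB)); [exact: GT|exact: GS].
- by move=> T GT B cB; apply: (csub_adj (proj1 cB)); exact: GT.
- move=> T aT Te B cB; apply: (csub_closed (proj1 cB)) => // e /Te[S GS eS].
  by exists S => //; exact: GS.
Qed.

End HilbertModuleTheory.

(** * Diagonal operators, the unilateral shift and the generators *)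

Section DiagonalShift.
Context {R : realType} {A : unitalCStarType R}.
Implicit Types (a b c : A) (u v x y z : nat -> A) (T S : op A).

Lemma extend0E (f : (nat -> A) -> (nat -> A)) x : l2 x -> extend0 f x = f x.
Proof. by move=> lx; rewrite /extend0 asboolT. Qed.

Lemma extend0_out (f : (nat -> A) -> (nat -> A)) x : ~ l2 x -> extend0 f x = 0.
Proof. by move=> lx; rewrite /extend0 asboolF. Qed.

Lemma adjoint_extend0 (f g : (nat -> A) -> (nat -> A)) :
  (forall x, l2 x -> l2 (f x)) -> (forall x, l2 x -> l2 (g x)) ->
  (forall x y, l2 x -> l2 y -> inner (f x) y = inner x (g y)) ->
  is_adjoint (extend0 f) (extend0 g).
Proof.
move=> lf lg fg; split.
- by split=> x lx; [rewrite extend0E //; exact: lf|rewrite extend0_out].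
- by split=> x lx; [rewrite extend0E //; exact: lg|rewrite extend0_out].
- by move=> x y lx ly; rewrite !extend0E //; exact: fg.
Qed.

Definition diag u : op A := extend0 (fun x j => u j ** x j).

Lemma adjoint_diag u (M : R) : (forall j, nrm (u j) <= M) ->
  is_adjoint (diag u) (diag (fun j => star (u j))).
Proof.
have ld v : (forall j, nrm (v j) <= M) -> forall x, l2 x -> l2 (fun j => v j ** x j).
  move=> vM x; apply: (l2_dominated (C := M ^+ 2)) => j.
  by apply: psd_cmul_bound.
move=> uM; apply: adjoint_extend0; first exact: ld.
- by apply: ld => j; rewrite nrm_star.
- move=> x y lx ly; congr (limn (series _)); apply/funext => j.
  by rewrite starM cmulA.
Qed.

Definition shift_seq u : nat -> A := fun j => if j is i.+1 then u i else 0.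

Lemma series_shift_cvg u (l : A) :
  (series (shift_seq u) @ \oo --> l) = (series u @ \oo --> l).
Proof.
have -> : series u = [sequence series (shift_seq u) n.+1]_n.
  by apply/funext => n; rewrite /series /= big_nat_recl //= add0r.
by rewrite cvg_shiftS.
Qed.

Lemma gram_shift x : gram (shift_seq x) = shift_seq (gram x).
Proof. by apply/funext => -[|j]; rewrite /gram //= cmul0r. Qed.

Lemma l2_shift x : l2 (shift_seq x) <-> l2 x.
Proof.
split=> [lx|lx]; apply: (cvgP (limn (series (gram _)))).
  by rewrite -series_shift_cvg -gram_shift; exact: lx.
by rewrite [X in series X]gram_shift series_shift_cvg; exact: lx.
Qed.

Definition shift_op : op A := extend0 shift_seq.
Definition unshift_op : op A := extend0 (fun x j => x j.+1).

Lemma adjoint_shift : is_adjoint shift_op unshift_op.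
Proof.
apply: adjoint_extend0.
- by move=> x /(proj2 (l2_shift x)).
- move=> x lx; apply: (proj1 (l2_shift _)).
  apply: (@l2_dominated _ _ 1 _ x) => // -[|j].
    by rewrite scale1r /gram /= cmul0r subr0; exact: psd_gram.
  by rewrite scale1r subrr; exact: psd0.
- move=> x y /(proj2 (l2_shift x)) lx ly; apply/esym/innerE.
  rewrite -series_shift_cvg.
  rewrite (_ : shift_seq _ = pairing (shift_seq x) y); first exact: inner_lim.
  by apply/funext => -[|j]; rewrite /pairing //= star0 cmul0l.
Qed.

(** Creation operators and weighted shifts both factor as the shift after a bounded diagonal
    operator, from which their adjoints are read off. *)
Lemma shift_diagE u (M : R) : (forall j, nrm (u j) <= M) ->
  shift_op \o diag u = extend0 (fun x => shift_seq (fun j => u j ** x j)).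
Proof.
move=> uM; have ad := adjoint_diag uM.
apply/funext => x /=; have [lx|nlx] := pselect (l2 x); last first.
  by rewrite extend0_out // (adjoint_out ad nlx) (adjoint_lin0 adjoint_shift).
rewrite [RHS]extend0E // [shift_op]/shift_op extend0E; last exact: adjoint_l2 ad lx.
by rewrite /diag extend0E.
Qed.

Section Generators.
Variables (alpha : A -> A) (halpha : star_automorphism alpha).

Lemma creationE n a :
  creation alpha n a = shift_op \o diag (fun j => iter (n * j) alpha a).
Proof.
by rewrite (shift_diagE (fun j => iter_aut_contract halpha (n * j) a)).
Qed.

Lemma adjoint_phi n a :
  is_adjoint (phi_infty alpha n a) (phi_infty alpha n (star a)).
Proof.
have -> : phi_infty alpha n (star a) = diag (fun j => star (iter (n * j) alpha a)).
  apply/funext => x; rewrite /phi_infty /diag /extend0; case: ifP => // _.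
  by apply/funext => j; rewrite iter_aut_star.
by apply: (@adjoint_diag _ (nrm a)) => j; exact: iter_aut_contract.
Qed.

Lemma adjointable_creation n a : adjointable (creation alpha n a).
Proof.
exists (diag (fun j => star (iter (n * j) alpha a)) \o unshift_op).
rewrite creationE; apply: adjoint_comp; first exact: adjoint_shift.
by apply: (@adjoint_diag _ (nrm a)) => j; exact: iter_aut_contract.
Qed.

Lemma adj_creation n a x : l2 x ->
  adj (creation alpha n a) x = fun j => iter (n * j) alpha (star a) ** x j.+1.
Proof.
move=> lx.
have h := adjoint_comp adjoint_shift (@adjoint_diag _ (nrm a)
  (fun j => iter_aut_contract halpha (n * j) a)).
rewrite creationE (adjE h) /= /diag extend0E; last first.
  exact: (adjoint_l2 (adjoint_sym adjoint_shift)).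
by apply/funext => j; rewrite iter_aut_star // /unshift_op extend0E.
Qed.

Lemma adjointable_weighted k lambda a : periodic_weight k lambda ->
  adjointable (weighted alpha lambda a).
Proof.
move=> [[M lM] _ _].
(* The bound is an element of [R[i]]; being above a norm, it is real. *)
have M0 : 0 <= M by apply: le_trans (lM 1%N isT).
have ME : M = (complex.Re M)%:C.
  by move: M0; rewrite lecE /= => /andP[/eqP]; case: (M) => p q /= ->.
pose u j := iter j alpha (lambda j.+1 ** a).
have bd j : nrm (u j) <= complex.Re M * nrm a.
  apply: (le_trans (iter_aut_contract halpha _ _)).
  apply: (le_trans (nrmM _ _)); apply: ler_wpM2r; first exact: nrm_ge0.
  by have := lM j.+1 isT; rewrite nrmE {1}ME leRC.
have -> : weighted alpha lambda a = shift_op \o diag u.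
  by rewrite (shift_diagE bd).
exists (diag (fun j => star (u j)) \o unshift_op).
by apply: adjoint_comp; [exact: adjoint_shift|exact: (adjoint_diag bd)].
Qed.

End Generators.
End DiagonalShift.

(** * Residue classes modulo k *)

Section Blocks.
Context {R : realType} {A : unitalCStarType R}.
Variable k : nat.
Hypothesis hk : (0 < k)%N.
Implicit Types (u v x y z : nat -> A) (T S : op A) (i j l : 'I_k).

(** On [l2], [ext i] is the isometry onto the coordinates congruent to [i] modulo [k], and [res i]
    is its adjoint. *)
Definition res (i : nat) x : nat -> A := fun m => x (m * k + i)%N.
Definition ext (i : nat) x : nat -> A :=
  fun n => if (n %% k)%N == i then x (n %/ k)%N else 0.

Lemma divn_block i m : ((m * k + i) %/ k)%N = m.
Proof. by rewrite divnMDl // divn_small // addn0. Qed.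

Lemma modn_block i m : ((m * k + i) %% k)%N = i.
Proof. by rewrite modnMDl modn_small. Qed.

Lemma res_ext i j x : res i (ext j x) = if i == j then x else 0.
Proof.
apply/funext => m; rewrite /res /ext modn_block divn_block -val_eqE /=.
by case: ifP.
Qed.

Lemma ext_res_sum x : \sum_(i < k) ext i (res i x) = x.
Proof.
apply/funext => n; rewrite fct_sumE /ext /res.
have nk : (n %% k < k)%N by rewrite ltn_mod.
rewrite (bigD1 (Ordinal nk)) //= eqxx -divn_eq big1 ?addr0 // => i.
by rewrite -val_eqE /= eq_sym => /negbTE ->.
Qed.

(** The quotient counts the integers below [n] congruent to [i] modulo [k]; passing to [n + 1]
    raises it exactly when [n] itself lies in that class. *)
Lemma series_ext i u n : series (ext i u) n = series u ((n + (k - i.+1)) %/ k)%N.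
Proof.
elim: n => [|n IH].
  rewrite /series /= add0n divn_small ?ltn_subrL ?hk //.
  by rewrite !big_geq.
rewrite /series /= big_nat_recr //=; move: IH; rewrite /series /= => ->.
have ik := ltn_ord i; have nk := ltn_pmod n hk; rewrite /ext.
have en := divn_eq n k; set q := (n %/ k)%N in en *; set r := (n %% k)%N in en nk *.
have dq s : (s < k)%N -> ((q * k + s) %/ k)%N = q.
  by move=> sk; rewrite divnMDl // divn_small // addn0.
have dq1 s : (s < k)%N -> ((q * k + (k + s)) %/ k)%N = q.+1.
  by move=> sk; rewrite addnA -mulSnr divnMDl // divn_small // addn0.
case: eqP => [ri|ri].
  have -> : (n + (k - i.+1) = q * k + k.-1)%N by lia.
  have -> : (n.+1 + (k - i.+1) = q * k + (k + 0))%N by lia.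
  by rewrite dq ?dq1 //; [rewrite big_nat_recr|lia].
rewrite addr0; have [ltri|ltir] : (r < i)%N \/ (i < r)%N by lia.
  have -> : (n + (k - i.+1) = q * k + (r + (k - i.+1)))%N by lia.
  have -> : (n.+1 + (k - i.+1) = q * k + (r + (k - i)))%N by lia.
  by rewrite !dq //; lia.
have -> : (n + (k - i.+1) = q * k + (k + (r - i.+1)))%N by lia.
have -> : (n.+1 + (k - i.+1) = q * k + (k + (r - i)))%N by lia.
by rewrite !dq1 //; lia.
Qed.

(** Each sequence of partial sums is the other one composed with a map of indices tending to
    infinity: m -> m k + i one way, the counting function the other. *)
Lemma series_ext_cvg i u (l : A) :
  (series (ext i u) @ \oo --> l) <-> (series u @ \oo --> l).
Proof.
have ik := ltn_ord i.
split=> ul.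
  have -> : series u = series (ext i u) \o (fun m => m * k + i)%N.
    apply/funext => m /=; rewrite series_ext -addnA divnMDl // divn_small ?addn0 //.
    by lia.
  apply: cvg_comp ul; apply/cvgnyPge => N; exists N => // m /= Nm; nia.
have -> : series (ext i u) = series u \o (fun n => (n + (k - i.+1)) %/ k)%N.
  by apply/funext => n; rewrite series_ext.
apply: cvg_comp ul; apply/cvgnyPge => N; exists (N * k)%N => // n /= Nn.
by rewrite leq_divRL //; lia.
Qed.

Lemma gram_ext i x : gram (ext i x) = ext i (gram x).
Proof. by apply/funext => n; rewrite /gram /ext; case: ifP => // _; rewrite cmul0r. Qed.

Lemma l2_ext i x : l2 (ext i x) <-> l2 x.
Proof.
split=> lx; apply: (cvgP (limn (series (gram _)))).
  by apply/(series_ext_cvg i); rewrite -gram_ext; exact: lx.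
by rewrite [X in series X]gram_ext; apply/series_ext_cvg; exact: lx.
Qed.

Lemma psd_gram_ext_res i x n : psd (gram x n - gram (ext i (res i x)) n).
Proof.
rewrite /gram /ext /res; case: eqP => [<-|_]; first by rewrite -divn_eq subrr; exact: psd0.
by rewrite cmul0r subr0; exact: psd_gram.
Qed.

Lemma l2_res i x : l2 x -> l2 (res i x).
Proof.
move=> lx; apply: (proj1 (l2_ext i _)).
apply: (@l2_dominated _ _ 1 _ x) => // n.
by rewrite scale1r; exact: psd_gram_ext_res.
Qed.

Arguments l2_res i {x} _.

Lemma inner_ext i x y : l2 x -> l2 y -> inner (ext i x) y = inner x (res i y).
Proof.
move=> lx ly; apply: innerE.
rewrite (_ : pairing _ _ = ext i (pairing x (res i y))).
  by apply/series_ext_cvg; apply: inner_lim => //; exact: l2_res.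
apply/funext => n; rewrite /pairing /ext /res; case: eqP => [<-|_]; first by rewrite -divn_eq.
by rewrite star0 cmul0l.
Qed.

Lemma inner_res i x y : l2 x -> l2 y -> inner (res i x) y = inner x (ext i y).
Proof.
move=> lx ly; have lr := l2_res i lx; have le := proj2 (l2_ext i y) ly.
by rewrite -inner_star // -inner_ext // inner_star.
Qed.

Lemma hnorm_ext i x : l2 x -> hnorm (ext i x) = hnorm x.
Proof.
move=> lx; rewrite /hnorm inner_ext //; last exact: (proj2 (l2_ext i x)).
by rewrite res_ext eqxx.
Qed.

Lemma hnorm_res i x : l2 x -> hnorm (res i x) <= hnorm x.
Proof.
move=> lx; rewrite -(hnorm_ext i (l2_res i lx)).
apply: ler_wsqrtr; apply: nrm_lim_dominated => //.
- by move=> n; exact: psd_gram.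
- by move=> n; exact: psd_gram_ext_res.
Qed.

Lemma opnorm_le T T' :
  (forall x, l2 x -> hnorm x <= 1 ->
     exists y, [/\ l2 y, hnorm y <= 1 & hnorm (T' x) <= hnorm (T y)]) ->
  (opnorm T' <= opnorm T)%E.
Proof.
move=> h; apply: ge_ereal_sup => _ [x [lx x1] <-].
have [y [ly y1 xy]] := h x lx x1.
apply: (@le_trans _ _ (hnorm (T y))%:E); first by rewrite lee_fin.
by apply: ereal_sup_ubound; exists y.
Qed.

(** [block] needs no cut-off, because [ext j x] is in [l2] only if [x] is, and so it is additive by
    computation. [unblock] does need one: [res j x] may be in [l2] when [x] is not. *)
Definition block (i j : nat) T : op A := fun x => res i (T (ext j x)).
Definition unblock (i j : nat) S : op A := extend0 (fun x => ext i (S (res j x))).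

Lemma adjoint_block i j T T' :
  is_adjoint T T' -> is_adjoint (block i j T) (block j i T').
Proof.
have ac (p q : 'I_k) S S' : is_adjoint S S' -> acts_on_l2 (block p q S).
  move=> SS'; split=> x lx; rewrite /block.
    by apply: l2_res; apply: (adjoint_l2 SS' (proj2 (l2_ext q x) lx)).
  by rewrite (adjoint_out SS') //; apply: contra_not lx => /(proj1 (l2_ext q x)).
move=> TT'; split; [exact: ac TT'|exact: ac (adjoint_sym TT')|].
move=> x y lx ly; rewrite /block.
have lx' := proj2 (l2_ext j x) lx; have ly' := proj2 (l2_ext i y) ly.
rewrite inner_res //; last exact: (adjoint_l2 TT').
have [_ _ ->] := TT' => //.
by rewrite inner_ext //; exact: (adjoint_l2 (adjoint_sym TT')).
Qed.

Lemma adjoint_unblock i j S S' :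
  is_adjoint S S' -> is_adjoint (unblock i j S) (unblock j i S').
Proof.
move=> SS'; apply: adjoint_extend0.
- by move=> x lx; exact: (proj2 (l2_ext i _) (adjoint_l2 SS' (l2_res j lx))).
- by move=> x lx; exact: (proj2 (l2_ext j _) (adjoint_l2 (adjoint_sym SS') (l2_res i lx))).
- move=> x y lx ly; have lx' := l2_res j lx; have ly' := l2_res i ly.
  rewrite inner_ext //; last exact: (adjoint_l2 SS').
  have [_ _ ->] := SS' => //.
  by rewrite inner_res //; exact: (adjoint_l2 (adjoint_sym SS')).
Qed.

Lemma opnorm_block i j T T' : is_adjoint T T' ->
  (opnorm (block i j T) <= opnorm T)%E.
Proof.
move=> TT'; apply: opnorm_le => x lx x1; exists (ext j x).
have le := proj2 (l2_ext j x) lx; split => //; first by rewrite hnorm_ext.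
by apply: hnorm_res; exact: (adjoint_l2 TT').
Qed.

Lemma opnorm_unblock i j S S' : is_adjoint S S' ->
  (opnorm (unblock i j S) <= opnorm S)%E.
Proof.
move=> SS'; apply: opnorm_le => x lx x1; exists (res j x).
have lr := l2_res j lx; split => //; first exact: le_trans (hnorm_res j lx) x1.
by rewrite /unblock extend0E // hnorm_ext //; exact: (adjoint_l2 SS').
Qed.

End Blocks.

(** * Operators as matrices of blocks *)

Section BlockDecomposition.
Context {R : realType} {A : unitalCStarType R}.
Variable k : nat.
Hypothesis hk : (0 < k)%N.
Implicit Types (a b c : A) (x y : nat -> A) (S T : op A) (i j l : 'I_k).

Lemma adjoint_l2_all T S x : is_adjoint T S -> l2 (T x).
Proof.
move=> TS; have [lx|nlx] := pselect (l2 x); first exact: (adjoint_l2 TS).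
by rewrite (adjoint_out TS nlx); exact: l2_0.
Qed.

Lemma block0 i j : block k i j (0 : op A) = 0.
Proof. by []. Qed.

Lemma blockD i j S T : block k i j (S + T) = block k i j S + block k i j T.
Proof. by []. Qed.

Lemma blockZ i j (z : R[i]) T : block k i j (z *: T) = z *: block k i j T.
Proof. by []. Qed.

Lemma block_sum i j (I : Type) (r : seq I) (F : I -> op A) :
  block k i j (\sum_(p <- r) F p) = \sum_(p <- r) block k i j (F p).
Proof. exact: (big_morph (block k i j) (blockD i j) (block0 i j)). Qed.

Lemma op_sumE (I : Type) (r : seq I) (F : I -> op A) x :
  (\sum_(p <- r) F p : op A) x = \sum_(p <- r) F p x.
Proof. exact: (big_morph (fun T : op A => T x)). Qed.

Lemma res_sum i (I : Type) (r : seq I) (F : I -> nat -> A) :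
  res k i (\sum_(p <- r) F p) = \sum_(p <- r) res k i (F p).
Proof. exact: (big_morph (res k i)). Qed.

(** The decomposition of a vector into its residue classes is inserted between [S] and [T], and
    linearity of [S] distributes over it. *)
Lemma block_comp i j S T : adjointable S -> adjointable T ->
  block k i j (S \o T) = \sum_(l < k) (block k i l S \o block k l j T : op A).
Proof.
move=> [S' SS'] [T' TT']; apply/funext => x; rewrite op_sumE /block /=.
have lw := adjoint_l2_all (x := ext k j x) TT'; set w := T _ in lw *.
rewrite -{1}(ext_res_sum hk w) (adjoint_lin_sum _ SS') ?res_sum // => l.
by apply: (proj2 (l2_ext hk l _)); exact: l2_res.
Qed.

Lemma adj_block i j T : adjointable T -> adj (block k i j T) = block k j i (adj T).
Proof. by move=> /adjointableE/(adjoint_block hk i j)/adjE. Qed.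

Lemma adjointable_block i j T : adjointable T -> adjointable (block k i j T).
Proof. by move=> [S TS]; exists (block k j i S); exact: adjoint_block. Qed.

Lemma adjointable_unblock i j T : adjointable T -> adjointable (unblock k i j T).
Proof. by move=> [S TS]; exists (unblock k j i S); exact: adjoint_unblock. Qed.

Lemma adj_unblock i j T : adjointable T -> adj (unblock k i j T) = unblock k j i (adj T).
Proof. by move=> /adjointableE/(adjoint_unblock hk i j)/adjE. Qed.

Lemma ext0 i : ext k i (0 : nat -> A) = 0.
Proof. by apply/funext => n; rewrite /ext if_same. Qed.

Lemma extD i x y : ext k i (x + y) = ext k i x + ext k i y.
Proof.
by apply/funext => n; rewrite /ext /GRing.add /=; case: ifP => //; rewrite addr0.
Qed.

Lemma extZ i (z : R[i]) x : ext k i (z *: x) = z *: ext k i x.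
Proof.
by apply/funext => n; rewrite /ext /GRing.scale /=; case: ifP => //; rewrite scaler0.
Qed.

Lemma unblock0 i j : unblock k i j (0 : op A) = 0.
Proof. by apply/funext => x; rewrite /unblock /extend0 ext0 if_same. Qed.

Lemma unblockD i j S T : unblock k i j (S + T) = unblock k i j S + unblock k i j T.
Proof.
apply/funext => x; have [lx|nlx] := pselect (l2 x).
  rewrite [RHS]/(unblock k i j S x + unblock k i j T x) /unblock !extend0E //.
  exact: extD.
rewrite [RHS]/(unblock k i j S x + unblock k i j T x) /unblock !extend0_out //.
exact: esym (addr0 _).
Qed.

Lemma unblockZ i j (z : R[i]) T : unblock k i j (z *: T) = z *: unblock k i j T.
Proof.
apply/funext => x; have [lx|nlx] := pselect (l2 x).
  rewrite [RHS]/(z *: unblock k i j T x) /unblock !extend0E //.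
  exact: extZ.
rewrite [RHS]/(z *: unblock k i j T x) /unblock !extend0_out //.
exact: esym (scaler0 _ _).
Qed.

Lemma unblockB i j S T : unblock k i j (S - T) = unblock k i j S - unblock k i j T.
Proof. by rewrite unblockD -scaleN1r unblockZ scaleN1r. Qed.

Lemma unblock_comp i l j S T : adjointable S -> adjointable T ->
  unblock k i j (S \o T) = unblock k i l S \o unblock k l j T.
Proof.
move=> [S' SS'] [T' TT']; apply/funext => x /=.
have lu := adjoint_l2_all (x := x) (adjoint_unblock hk l j TT').
rewrite [RHS](extend0E _ lu) /unblock.
have [lx|nlx] := pselect (l2 x); last first.
  by rewrite !extend0_out //= (_ : res k l 0 = 0) // (adjoint_lin0 SS') ext0.
by rewrite !extend0E // res_ext // eqxx.
Qed.

Lemma block_unblock i j i' j' S : adjointable S ->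
  block k i j (unblock k i' j' S) = if (i == i') && (j == j') then S else 0.
Proof.
move=> [S' SS']; apply/funext => x; rewrite /block /unblock.
have [lx|nlx] := pselect (l2 x).
  rewrite extend0E; last exact: (proj2 (l2_ext hk j x) lx).
  rewrite !res_ext // [j' == j]eq_sym; case: (i == i'); case: (j == j') => //=.
  by rewrite (adjoint_lin0 SS').
rewrite extend0_out; last by apply: contra_not nlx => /(proj1 (l2_ext hk j x)).
by case: ifP => // _; rewrite (adjoint_out SS' nlx).
Qed.

Lemma block_inj S T : adjointable S -> adjointable T ->
  (forall i j, block k i j S = block k i j T) -> S = T.
Proof.
move=> [S' SS'] [T' TT'] ST; apply/funext => x.
have [lx|nlx] := pselect (l2 x); last by rewrite (adjoint_out SS' nlx) (adjoint_out TT' nlx).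
have le j : l2 (ext k j (res k j x)).
  by apply: (proj2 (l2_ext hk j _)); exact: l2_res.
rewrite -(ext_res_sum hk x) (adjoint_lin_sum _ SS') // (adjoint_lin_sum _ TT') //.
apply: eq_bigr => j _; rewrite -(ext_res_sum hk (S _)) -(ext_res_sum hk (T _)).
by apply: eq_bigr => i _; congr (ext k i _); exact: (congr1 (fun U => U (res k j x)) (ST i j)).
Qed.

Lemma csub_sum (B : set (op A)) (I : Type) (r : seq I) (F : I -> op A) :
  cstar_subalgebra B -> (forall p, B (F p)) -> B (\sum_(p <- r) F p).
Proof.
by move=> cB BF; elim/big_ind: _ => //; [exact: csub0 cB|exact: csubD cB].
Qed.

(** A product mixes all blocks and an adjoint transposes them, hence the quantification over every
    [i] and [j]. Closedness holds because an approximation of [T] approximates each block at least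
    as well. *)
Lemma cstar_subalgebra_blocks (B : set (op A)) : cstar_subalgebra B ->
  cstar_subalgebra [set T | adjointable T /\ forall i j, B (block k i j T)].
Proof.
move=> cB; have cA := @cstar_subalgebra_adjointable R A; split.
- by move=> T [].
- by split=> [|i j]; [exact: csub0 cA|exact: csub0 cB].
- move=> S T [aS BS] [aT BT]; split=> [|i j]; first exact: (csubD cA aS aT).
  by rewrite blockD; apply: (csubD cB).
- move=> z T [aT BT]; split=> [|i j]; first exact: (csubZ cA z aT).
  by rewrite blockZ; apply: (csubZ cB).
- move=> S T [aS BS] [aT BT]; split=> [|i j]; first exact: (csubM cA aS aT).
  by rewrite block_comp //; apply: csub_sum => // l; apply: (csubM cB).
- move=> T [aT BT]; split=> [|i j]; first exact: (csub_adj cA aT).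
  by rewrite -adj_block //; apply: (csub_adj cB).
- move=> T aT Te; split=> // i j.
  apply: (csub_closed cB); first exact: adjointable_block.
  move=> e /Te[S [aS BS] ST]; exists (block k i j S) => //.
  apply: le_lt_trans ST; rewrite -[X in opnorm X]/(block k i j (T - S)).
  have [U TU] := csubD cA aT (csubZ cA (-1) aS); rewrite scaleN1r in TU.
  exact: (opnorm_block hk i j TU).
Qed.

(** A product at position (i, j) splits as the first factor at (i, i) times the second at (i, j), so
    membership at one fixed position would not be stable. *)
Lemma cstar_subalgebra_unblocks (B : set (op A)) : cstar_subalgebra B ->
  cstar_subalgebra [set S | adjointable S /\ forall i j, B (unblock k i j S)].
Proof.
move=> cB; have cA := @cstar_subalgebra_adjointable R A; split.
- by move=> T [].
- by split=> [|i j]; [exact: csub0 cA|rewrite unblock0; exact: csub0 cB].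
- move=> S T [aS BS] [aT BT]; split=> [|i j]; first exact: (csubD cA aS aT).
  by rewrite unblockD; apply: (csubD cB).
- move=> z T [aT BT]; split=> [|i j]; first exact: (csubZ cA z aT).
  by rewrite unblockZ; apply: (csubZ cB).
- move=> S T [aS BS] [aT BT]; split=> [|i j]; first exact: (csubM cA aS aT).
  by rewrite (unblock_comp i i j) //; apply: (csubM cB).
- move=> T [aT BT]; split=> [|i j]; first exact: (csub_adj cA aT).
  by rewrite -adj_unblock //; apply: (csub_adj cB).
- move=> T aT Te; split=> // i j.
  apply: (csub_closed cB); first exact: adjointable_unblock.
  move=> e /Te[S [aS BS] ST]; exists (unblock k i j S) => //.
  apply: le_lt_trans ST; rewrite -unblockB.
  have [U TU] := csubD cA aT (csubZ cA (-1) aS); rewrite scaleN1r in TU.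
  exact: (opnorm_unblock hk i j TU).
Qed.

End BlockDecomposition.

(** * The two algebras *)

Section ToeplitzPeriodic.
Context {R : realType} {A : unitalCStarType R}.
Variables (alpha : A -> A) (k : nat).
Hypotheses (halpha : star_automorphism alpha) (hk : (0 < k)%N).
Implicit Types (a b c : A) (x y : nat -> A) (S T : op A) (i j l : 'I_k).

Local Notation phi := (phi_infty alpha k).
Local Notation cre := (creation alpha k).

Lemma phi_adjointable a : adjointable (phi a).
Proof. by exists (phi (star a)); exact: adjoint_phi. Qed.

Lemma cre_adjointable a : adjointable (cre a).
Proof. exact: adjointable_creation. Qed.

Lemma toeplitz_csub : cstar_subalgebra (toeplitz alpha k).
Proof.
apply: cstar_subalgebra_gen => T [] [a _ <-].
- exact: phi_adjointable.
- exact: cre_adjointable.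
Qed.

Lemma periodic_csub : cstar_subalgebra (periodic_algebra alpha k).
Proof.
apply: cstar_subalgebra_gen => T [lambda [a [pl ->]]].
exact: adjointable_weighted pl.
Qed.

Lemma toeplitz_phi a : toeplitz alpha k (phi a).
Proof. by move=> B [_ GB]; apply: GB; left; exists a. Qed.

Lemma toeplitz_cre a : toeplitz alpha k (cre a).
Proof. by move=> B [_ GB]; apply: GB; right; exists a. Qed.

Lemma periodic_weighted lambda a : periodic_weight k lambda ->
  periodic_algebra alpha k (weighted alpha lambda a).
Proof. by move=> pl B [_ GB]; apply: GB; exists lambda, a. Qed.

Lemma phi0 : phi 0 = 0.
Proof.
apply/funext => x; rewrite /phi_infty /extend0; case: ifP => // _.
by apply/funext => n; rewrite iter_aut0 // cmul0l.
Qed.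

Lemma cre0 : cre 0 = 0.
Proof.
apply/funext => x; rewrite /creation /extend0; case: ifP => // _.
by apply/funext => -[|n] //; rewrite iter_aut0 // cmul0l.
Qed.

Lemma phi_comp a b : phi a \o phi b = phi (a ** b).
Proof.
have ab := adjoint_phi halpha k b.
apply/funext => x; change (phi a (phi b x) = phi (a ** b) x).
have [lx|nlx] := pselect (l2 x); last first.
  rewrite (adjoint_out ab nlx) (adjoint_out (adjoint_phi halpha k (a ** b)) nlx).
  exact: (adjoint_lin0 (adjoint_phi halpha k a)).
rewrite [LHS](extend0E _ (adjoint_l2 ab lx)) /phi_infty !extend0E //.
by apply/funext => n; rewrite iter_aut_mul // cmulA.
Qed.

Lemma phi1E x : l2 x -> phi cone x = x.
Proof.
move=> lx; rewrite [LHS]extend0E //; apply/funext => n.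
by rewrite iter_aut_cone // cmul1l.
Qed.

Lemma phi1_comp T : adjointable T -> phi cone \o T = T.
Proof. by move=> [S TS]; apply/funext => x; exact: phi1E (adjoint_l2_all TS). Qed.

Lemma comp_phi1 T : adjointable T -> T \o phi cone = T.
Proof.
move=> [S TS]; apply/funext => x; change (T (phi cone x) = T x).
have [lx|nlx] := pselect (l2 x); first by rewrite phi1E.
rewrite (adjoint_out (adjoint_phi halpha k cone) nlx).
by rewrite (adjoint_lin0 TS) (adjoint_out TS nlx).
Qed.

Lemma adj_phi a : adj (phi a) = phi (star a).
Proof. exact/adjE/adjoint_phi. Qed.

Lemma adj_cre1_comp a : adj (cre cone) \o cre a = phi a.
Proof.
have [S cS] := cre_adjointable a; have c1 := adjointableE (cre_adjointable cone).
apply/funext => x; change (adj (cre cone) (cre a x) = phi a x).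
have [lx|nlx] := pselect (l2 x); last first.
  rewrite (adjoint_out cS nlx) (adjoint_lin0 (adjoint_sym c1)).
  by rewrite (adjoint_out (adjoint_phi halpha k a) nlx).
rewrite [LHS]adj_creation //; last exact: (adjoint_l2 cS).
rewrite [cre a x]extend0E // [RHS]extend0E //; apply/funext => n.
by rewrite star_cone iter_aut_cone // cmul1l.
Qed.

(** For [k = 1] the only entry is the corner one, [cre b]. *)
Definition weighted_block (i j : nat) b : op A :=
  if i == j.+1 then phi b else if (i == 0) && (j.+1 == k) then cre b else 0.

Lemma toeplitz_weighted_block i j b : toeplitz alpha k (weighted_block i j b).
Proof.
rewrite /weighted_block; case: ifP => _; first exact: toeplitz_phi.
by case: ifP => _; [exact: toeplitz_cre|exact: csub0 toeplitz_csub].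
Qed.

Lemma weighted_block0 i j : weighted_block i j 0 = 0.
Proof. by rewrite /weighted_block phi0 cre0 !if_same. Qed.

Lemma periodic_weightE (lambda : nat -> A) m i : periodic_weight k lambda ->
  lambda (m * k + i).+1 = lambda i.+1.
Proof.
move=> [_ _ pl]; elim: m => [|m IH]; first by rewrite add0n.
by rewrite mulSn -addnA addnC -addSn pl.
Qed.

(** A weighted shift sends coordinate m k + j to its successor, with coefficient the (m k)-th
    iterate of [alpha] at [b], since periodicity makes the weight independent of m. This is the
    coefficient of [phi b] and of [cre b]. *)
Lemma block_weighted lambda a i j : periodic_weight k lambda ->
  block k i j (weighted alpha lambda a)
    = weighted_block i j (iter j alpha (lambda j.+1 ** a)).
Proof.
move=> pl; set b := iter j alpha _; apply/funext => x; rewrite /block.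
have [lx|nlx] := pselect (l2 x); last first.
  rewrite [weighted _ _ _ _]extend0_out; last first.
    by apply: contra_not nlx => /(proj1 (l2_ext hk j x)).
  rewrite /weighted_block; case: ifP => _; first by rewrite [RHS]extend0_out.
  by case: ifP => // _; rewrite [RHS]extend0_out.
have iterE m : iter (m * k + j) alpha (lambda (m * k + j).+1 ** a) = iter (k * m) alpha b.
  by rewrite periodic_weightE // iterD mulnC.
have extE m (p : nat) : (p < k)%N ->
    ext k j x (m * k + p)%N = if p == j then x m else 0.
  move=> pk; rewrite /ext; have := modn_block (Ordinal pk) m => /= ->.
  by have := divn_block hk (Ordinal pk) m => /= ->.
rewrite [weighted _ _ _ _]extend0E; last exact: (proj2 (l2_ext hk j x) lx).
apply/funext => m; rewrite /res /weighted_block.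
have ik := ltn_ord i; have jk := ltn_ord j.
(* Coordinate m k + i receives from its predecessor: row 0 from class k - 1 of the previous period
   (from nothing when m = 0), row p + 1 from class p of the same period. *)
case: (nat_of_ord i) ik => [_|p pk].
  rewrite addn0 /=; case: m => [|m].
    by rewrite mul0n; case: ifP => // _; rewrite [cre b x]extend0E.
  have -> : (m.+1 * k = (m * k + k.-1).+1)%N by lia.
  rewrite extE; last by lia.
  have [jk1|jk1] := eqVneq j.+1 k.
    have -> : (k.-1 == j) = true by apply/eqP; lia.
    have -> : k.-1 = j by lia.
    by rewrite iterE [cre b x]extend0E.
  have -> : (k.-1 == j) = false by apply/eqP => h; move/eqP: jk1; lia.
  by rewrite cmul0r.
rewrite addnS extE; last by lia.
rewrite eqSS /=; case: eqP => [pj|_]; last by rewrite cmul0r.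
by rewrite pj iterE [phi b x]extend0E.
Qed.

Lemma periodic_blocks T : periodic_algebra alpha k T ->
  forall i j, toeplitz alpha k (block k i j T).
Proof.
move=> /(_ [set T | adjointable T /\ forall i j, toeplitz alpha k (block k i j T)]) h.
apply: (proj2 (h _)); split; first exact: (cstar_subalgebra_blocks hk toeplitz_csub).
move=> _ [lambda [a [pl ->]]]; split=> [|i j]; first exact: adjointable_weighted pl.
by rewrite block_weighted //; exact: toeplitz_weighted_block.
Qed.

(** The spectrum of a scalar contains at most that scalar: for z different from r, the multiple of
    the unit by the inverse of r - z is the resolvent. *)
Lemma positive_real (r : R) : 0 <= r -> positive (r%:C *: (cone : A)).
Proof.
move=> r0; split=> [|z]; first by rewrite starZR star_cone.
move=> nz; have [->|zr] := eqVneq z r%:C; first by rewrite lecE /= eqxx.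
case: nz; exists ((r%:C - z)^-1 *: cone).
rewrite -scalerBl !cmulZl !cmulZr !cmul1l !scalerA.
by rewrite mulVf ?divff ?scale1r // subr_eq0 eq_sym.
Qed.

(** The class is that of i + 1 because weights are numbered from 1: the weight with index j + 1 acts
    on coordinate j. *)
Definition indicator_weight i : nat -> A :=
  fun n => if (n == i.+1 %[mod k])%N then cone else 0.

Lemma indicator_periodic i : periodic_weight k (indicator_weight i).
Proof.
split.
- exists `|cone : A| => n _; rewrite /indicator_weight; case: ifP => // _.
  by rewrite normr0.
- move=> n _; rewrite /indicator_weight; case: ifP => _.
    by rewrite -[cone]scale1r; have := positive_real (@ler01 R); rewrite rmorph1.
  by have := positive_real (lexx (0 : R)); rewrite scale0r.
- by move=> n _; rewrite /indicator_weight modnDr.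
Qed.

Lemma indicator_weightE i j :
  indicator_weight i j.+1 = if j == i then cone else 0.
Proof.
rewrite /indicator_weight -val_eqE /= -[j.+1]addn1 -[i.+1]addn1 eqn_modDr.
by rewrite !modn_small.
Qed.

Definition per (i j : nat) S := periodic_algebra alpha k (unblock k i j S).

(** An indicator weight kills every column except [i]; if that column has a single nonzero entry
    [S], the weighted shift is [S] placed at (l, i). *)
Lemma weighted_indicator i l b S : adjointable S ->
  weighted_block l i b = S ->
  (forall j, j != l -> weighted_block j i b = 0) -> per l i S.
Proof.
(* The entry in column [i] is twisted by the i-th iterate of [alpha], so surjectivity of [alpha] is
   what makes every [b] occur. *)
move=> aS Sl S0; have [a ab] := iter_aut_surj halpha i b.
have pw := indicator_periodic i.
rewrite /per (_ : unblock _ _ _ _ = weighted alpha (indicator_weight i) a).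
  exact: periodic_weighted.
apply: (block_inj hk).
- exact: adjointable_unblock.
- exact: adjointable_weighted pw.
move=> p q; rewrite block_unblock // block_weighted // indicator_weightE.
have [->|qi] := eqVneq q i; last by rewrite andbF cmul0l iter_aut0 // weighted_block0.
by rewrite cmul1l ab andbT; case: eqVneq => [->|/S0].
Qed.

Lemma per_phi_succ i l b : l = i.+1 :> nat -> per l i (phi b).
Proof.
move=> li; apply: (@weighted_indicator _ _ b); first exact: phi_adjointable.
  by rewrite /weighted_block li eqxx.
move=> j; rewrite -val_eqE /= li /weighted_block => /negbTE ->.
by have lk := ltn_ord l; rewrite li in lk; rewrite (ltn_eqF lk) andbF.
Qed.

Lemma per_cre i l b : l = 0%N :> nat -> i.+1 = k -> per l i (cre b).
Proof.
move=> l0 ik; apply: (@weighted_indicator _ _ b); first exact: cre_adjointable.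
  by rewrite /weighted_block l0 /= ik eqxx.
move=> j; rewrite -val_eqE /= l0 /weighted_block => /negbTE ->.
by rewrite ik; case: eqP => // jk; have := ltn_ord j; rewrite jk ltnn.
Qed.

Lemma per_comp i l j S T : adjointable S -> adjointable T ->
  per i l S -> per l j T -> per i j (S \o T).
Proof.
by move=> aS aT pS pT; rewrite /per (unblock_comp hk i l j) //; apply: (csubM periodic_csub).
Qed.

Lemma per_adj i j S : adjointable S -> per i j S -> per j i (adj S).
Proof.
by move=> aS pS; rewrite /per -adj_unblock //; apply: (csub_adj periodic_csub).
Qed.

(** Column [i] has one available entry: [phi] just below the diagonal, or [cre] in the corner when
    [i] is last. Multiplying it on the left by the adjoint of its value at the unit returns [phi a]
    to the diagonal. *)
Lemma per_phi_diag i a : per i i (phi a).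
Proof.
have [ik|ik] := ltnP i.+1 k.
  have h b : per (Ordinal ik) i (phi b) by exact: per_phi_succ.
  have hs := per_adj (phi_adjointable cone) (h cone).
  rewrite adj_phi star_cone in hs.
  have := per_comp (phi_adjointable _) (phi_adjointable _) hs (h a).
  by rewrite phi_comp cmul1l.
have ik' : i.+1 = k by have := ltn_ord i; lia.
have h b : per (Ordinal hk) i (cre b) by exact: per_cre.
have ac1 := csub_adj (@cstar_subalgebra_adjointable R A) (cre_adjointable cone).
have := per_comp ac1 (cre_adjointable a) (per_adj (cre_adjointable cone) (h cone)) (h a).
by rewrite adj_cre1_comp.
Qed.

(** Starting on the diagonal, each left multiplication by [phi cone] placed just below it moves the
    entry down one row. *)
Lemma per_phi_lower d i j a : j = (i + d)%N :> nat -> per j i (phi a).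
Proof.
elim: d j => [|d IH] j.
  rewrite addn0 => /val_inj ->; exact: per_phi_diag.
rewrite addnS => jE; have lk : (i + d < k)%N by have := ltn_ord j; lia.
have h1 := @per_phi_succ (Ordinal lk) j cone jE.
have h2 := IH (Ordinal lk) erefl.
have := per_comp (phi_adjointable _) (phi_adjointable _) h1 h2.
by rewrite phi_comp cmul1l.
Qed.

Lemma per_phi i j a : per i j (phi a).
Proof.
have low (p q : 'I_k) b : (q <= p)%N -> per p q (phi b).
  by move=> qp; apply: (@per_phi_lower (p - q)); lia.
have [ji|ij] := leqP j i; first exact: low.
rewrite -[a]starK -adj_phi; apply: per_adj; first exact: phi_adjointable.
by apply: low; exact: ltnW.
Qed.

(** Placed copies of [phi cone] act as matrix units, since [phi cone] is the identity on [l2]; two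
    of them carry the corner entry to any position. *)
Lemma per_cre_all i j a : per i j (cre a).
Proof.
have kk : (k.-1 < k)%N by lia.
have h := @per_cre (Ordinal kk) (Ordinal hk) a erefl (prednK hk).
have h1 := per_comp (phi_adjointable _) (cre_adjointable _) (per_phi i _ cone) h.
rewrite phi1_comp in h1; last exact: cre_adjointable.
have := per_comp (cre_adjointable _) (phi_adjointable _) h1 (per_phi _ j cone).
by rewrite comp_phi1 //; exact: cre_adjointable.
Qed.

Lemma periodic_unblocks S : toeplitz alpha k S -> forall i j, per i j S.
Proof.
move=> /(_ [set S | adjointable S /\ forall i j, per i j S]) h.
apply: (proj2 (h _)); split; first exact: (cstar_subalgebra_unblocks hk periodic_csub).
move=> _ [] [a _ <-]; split=> [|i j].
- exact: phi_adjointable.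
- exact: per_phi.
- exact: cre_adjointable.
- exact: per_cre_all.
Qed.

End ToeplitzPeriodic.

(** * The isomorphism: an operator goes to the matrix of its blocks *)

Theorem lemma2p3 (R : realType) (A : unitalCStarType R) (alpha : A -> A)
    (k : nat) (hsep : separable A) (halpha : star_automorphism alpha)
    (hk : (1 <= k)%N) :
  star_isomorphic (op_algebra (periodic_algebra alpha k))
                  (mx_algebra k (toeplitz alpha k)).
Proof.
have aP T : periodic_algebra alpha k T -> adjointable T.
  exact: (csub_adjointable (periodic_csub k halpha)).
have aT T : toeplitz alpha k T -> adjointable T.
  exact: (csub_adjointable (toeplitz_csub k halpha)).
exists (fun T : op A => \matrix_(i < k, j < k) block k i j T); split.
- split.
  + by move=> T PT i j; rewrite mxE; exact: (periodic_blocks halpha hk).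
  + move=> S T; rewrite !inE /= => PS PT ST.
    apply: (block_inj hk (aP _ PS) (aP _ PT)) => i j.
    by have := congr1 (fun M : 'M[op A]_k => M i j) ST; rewrite !mxE.
  + move=> M /= TM; pose F (i j : 'I_k) := unblock k i j (M i j).
    (* The preimage of [M] is the finite sum of its entries put back in place; reading off block (p,
       q) leaves only the term with i = p and j = q. *)
    exists (\sum_(i < k) \sum_(j < k) F i j : op A).
      apply: (csub_sum _ (periodic_csub k halpha)) => i.
      apply: (csub_sum _ (periodic_csub k halpha)) => j.
      exact: (periodic_unblocks halpha hk).
    apply/matrixP => p q; rewrite mxE block_sum (bigD1 p) //= [X in _ + X]big1; last first.
      move=> i ip; rewrite block_sum big1 // => j _.
      by rewrite block_unblock ?[p == i]eq_sym ?(negbTE ip) //; exact: aT.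
    rewrite addr0 block_sum (bigD1 q) //= big1; last first.
      move=> j jq; rewrite block_unblock ?[q == j]eq_sym ?(negbTE jq) ?andbF //.
      exact: aT.
    by rewrite addr0 block_unblock ?eqxx //; exact: aT.
- by move=> S T _ _; apply/matrixP => i j; rewrite !mxE.
- by move=> c T _; apply/matrixP => i j; rewrite !mxE.
- move=> S T PS PT; apply/matrixP => i j; rewrite !mxE block_comp //; try exact: aP.
  by apply: eq_bigr => l _; rewrite !mxE.
- by move=> T PT; apply/matrixP => i j; rewrite !mxE adj_block //; exact: aP.
Qed.
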